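(* Let $\boldsymbol\mu=\{\mu_\beta\}_{|\beta|\ge1}$ be a weight sequence of strictly positive numbers and let $W=(W_1,\ldots,W_n)$ be the associated weighted left multi-shift. Let $T=(T_1,\ldots,T_n)\in B(\mathcal H)^n$ and suppose there are a positive invertible operator $Q\in B(\mathcal H)$ and constants $0<a\le b$ such that $$aI\le\sum_{k=0}^\infty\sum_{\alpha\in\mathbb F_n^+,|\alpha|=k}\frac1{\boldsymbol\mu(\alpha,g_0)^2}T_\alpha QT_\alpha^*\le bI.$$ Then $(T_1,\ldots,T_n)$ is jointly similar to $$(P_{\mathcal M}(W_1\otimes I_{\mathcal H})|_{\mathcal M},\ldots,P_{\mathcal M}(W_n\otimes I_{\mathcal H})|_{\mathcal M}),$$ where $\mathcal M\subset F^2(H_n)\otimes\mathcal H$ is a joint invariant (closed) subspace under the operators $W_i^*\otimes I_{\mathcal H}$, $i\in\{1,\ldots,n\}$. In this case, $r(T)\le r(W)$ and the map $\Phi_T:\mathcal A(\boldsymbol\mu)\to B(\mathcal H)$ defined by $$\Phi_T(p(W_1,\ldots,W_n)):=p(T_1,\ldots,T_n)$$ for noncommutative polynomials $p$ (and extended to $\mathcal A(\boldsymbol\mu)$ by continuity) is completely bounded and $\|\Phi_T\|_{cb}\le\sqrt{b/a}$.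
   Context: Let $n\ge 1$ and let $\mathbb F_n^+$ be the unital free semigroup on generators $g_1,\ldots,g_n$ with identity $g_0$; $|\alpha|$ is the length of $\alpha$. $F^2(H_n)$ is the full Fock space, a Hilbert space with orthonormal basis $\{e_\alpha\}_{\alpha\in\mathbb F_n^+}$. For operators $T_1,\ldots,T_n$, $T_\alpha:=T_{i_1}\cdots T_{i_k}$ if $\alpha=g_{i_1}\cdots g_{i_k}$, $T_{g_0}:=I$. The weighted left multi-shift associated with $\boldsymbol\mu$ is $W_ie_\alpha=\mu_{g_i\alpha}e_{g_i\alpha}$; it is always assumed that $\sup_\alpha\mu_{g_i\alpha}<\infty$ for each $i$. Set $\boldsymbol\mu(\alpha,g_0):=\mu_{g_{i_1}\cdots g_{i_k}}\mu_{g_{i_2}\cdots g_{i_k}}\cdots\mu_{g_{i_k}}$ if $\alpha=g_{i_1}\cdots g_{i_k}$ and $\boldsymbol\mu(g_0,g_0):=1$. The series of positive operators is understood to converge in the weak operator topology. The joint spectral radius is $r(T):=\lim_{k\to\infty}\|\sum_{|\alpha|=k}T_\alpha T_\alpha^*\|^{1/2k}$. $\mathcal A(\boldsymbol\mu)$ is the norm-closed non-self-adjoint algebra generated by $W_1,\ldots,W_n$ and the identity. $T\in B(\mathcal H)^n$ is jointly similar to $A\in B(\mathcal K)^n$ if there is an invertible $X:\mathcal H\to\mathcal K$ with $T_i=X^{-1}A_iX$ for all $i$. $P_{\mathcal M}$ is the orthogonal projection onto $\mathcal M$. *)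

(* Defs.v *)
From HB Require Import structures.
From mathcomp Require Import all_boot all_order all_algebra.
From mathcomp Require Import finmap monalg.
From mathcomp Require Import all_classical all_reals all_analysis.
From mathcomp Require Import complex.

Set Implicit Arguments.
Unset Strict Implicit.
Unset Printing Implicit Defensive.

Import Order.TTheory GRing.Theory Num.Theory numFieldNormedType.Exports.
Local Open Scope classical_set_scope.
Local Open Scope complex_scope.
Local Open Scope ring_scope.

(* The norm of a normed module over R[i] takes its values in R[i]; [rnorm] is
   the same norm as a real number. *)
Definition rnorm (R : realType) (V : normedModType R[i]) (x : V) : R :=
  complex.Re `|x|.

Section rnorm_theory.
Variables (R : realType) (V : normedModType R[i]).
Implicit Types x y : V.

Lemma rnormE x : (rnorm x)%:C = `|x|.
Proof. by rewrite /rnorm RRe_real// normr_real. Qed.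

Lemma rnorm_ge0 x : 0 <= rnorm x.
Proof. by rewrite -ler0c rnormE. Qed.

Lemma rnormD x y : rnorm (x + y) <= rnorm x + rnorm y.
Proof. by rewrite -lecR rmorphD/= !rnormE ler_normD. Qed.

Lemma re_normE (k : R[i]) : real_complex R (complex.Re `|k|) = `|k|.
Proof. by rewrite RRe_real// normr_real. Qed.

Lemma real_complexM (a b : R) : (a * b)%:C = a%:C * b%:C.
Proof. exact: (rmorphM (real_complex R)). Qed.

Lemma rnormZ (k : R) x : rnorm (k%:C *: x) = `|k| * rnorm x.
Proof.
apply: complexI; rewrite real_complexM !rnormE normrZ; congr (_ * _).
by rewrite normc_def/= expr0n addr0 sqrtr_sqr.
Qed.

End rnorm_theory.

(* [hdot] is linear in its first variable and conjugate-linear in the second. *)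
HB.mixin Record NormedModule_isHilbert (R : realType) H
    & CompleteNormedModule R[i] H := {
  hdot : {dot H for @Num.conj R[i]};
  sqr_normE : forall x : H, `|x| ^+ 2 = hdot x x
}.

#[short(type="hilbertType")]
HB.structure Definition Hilbert (R : realType) :=
  {H of CompleteNormedModule R[i] H & NormedModule_isHilbert R H}.

Notation "'[ x , y ]" := (hdot x y) : ring_scope.

Section bounded_operators.
Variables (R : realType) (V W : normedModType R[i]).

Implicit Types x y : V.

Definition is_bop : {pred V -> W} := fun f => `[< linear f /\ continuous f >].

Record bop := Bop { bop_fun :> V -> W; bopP : bop_fun \in is_bop }.

HB.instance Definition _ := [isSub for bop_fun].
HB.instance Definition _ := [Choice of bop by <:].

Implicit Types A B : bop.

Lemma is_bop_submod : GRing.submod_closed is_bop.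
Proof.
split.
  apply/asboolP; split=> [k x y|x]; first by rewrite /= scaler0 addr0.
  exact: cst_continuous.
move=> k f g /asboolP[lf cf] /asboolP[lg cg]; apply/asboolP; split.
  move=> c x y; rewrite !fctE lf lg !scalerDr !scalerA addrACA.
  by rewrite [k * c]mulrC.
by move=> x; apply: cvgD; [apply: cvgZr; exact: cf|exact: cg].
Qed.

HB.instance Definition _ :=
  GRing.isSubmodClosed.Build R[i] (V -> W) is_bop is_bop_submod.
HB.instance Definition _ := [SubChoice_isSubLmodule of bop by <:].

Lemma bop_linear (A : bop) : linear A.
Proof. by have /asboolP[] := bopP A. Qed.

HB.instance Definition _ (A : bop) :=
  GRing.isLinear.Build R[i] V W *:%R A (bop_linear A).

Lemma bop_continuous (A : bop) : continuous A.
Proof. by have /asboolP[] := bopP A. Qed.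

Definition unit_ball_image (A : bop) : set R :=
  [set rnorm (A x) | x in [set x | rnorm x <= 1]].

Definition opnorm (A : bop) : R := sup (unit_ball_image A).

Lemma has_sup_unit_ball_image A : has_sup (unit_ball_image A).
Proof.
split; first by exists (rnorm (A 0)), 0 => //=; rewrite /rnorm normr0.
have /linear_bounded_continuous/linear_boundedP := @bop_continuous A.
move=> /pinfty_ex_gt0[r r0 Ar]; exists (complex.Re r) => _ [x /= x1 <-].
rewrite -lecR rnormE RRe_real ?gtr0_real//; apply: le_trans (Ar x) _.
by rewrite -[leRHS]mulr1 ler_wpM2l ?(ltW r0)// -rnormE lecR.
Qed.

Lemma opnorm_unit A x : rnorm x <= 1 -> rnorm (A x) <= opnorm A.
Proof.
by move=> x1; apply: ub_le_sup; [case: (has_sup_unit_ball_image A)|exists x].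
Qed.

Lemma opnorm_ge0 A : 0 <= opnorm A.
Proof.
apply: le_trans (@opnorm_unit A 0 _); first exact: rnorm_ge0.
by rewrite /rnorm normr0.
Qed.

Lemma opnorm_le A m : (forall x, rnorm x <= 1 -> rnorm (A x) <= m) ->
  opnorm A <= m.
Proof.
move=> Am; apply: ge_sup; first by case: (has_sup_unit_ball_image A).
by move=> _ [x /= x1 <-]; exact: Am.
Qed.

Lemma opnorm_bound A x : rnorm (A x) <= opnorm A * rnorm x.
Proof.
have [->|x0] := eqVneq x 0; first by rewrite linear0 /rnorm !normr0 mulr0.
have x_gt0 : 0 < rnorm x by rewrite -ltcR rnormE normr_gt0.
have := @opnorm_unit A ((rnorm x)^-1%:C *: x).
rewrite linearZ/= !rnormZ normfV (gtr0_norm x_gt0) mulVf ?gt_eqF// lexx.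
by rewrite ler_pdivrMl// mulrC => ->.
Qed.

Lemma bopD (A B : bop) x : (A + B) x = A x + B x. Proof. by []. Qed.

Lemma bopZ k (A : bop) x : (k *: A) x = k *: A x. Proof. by []. Qed.

Lemma opnormD A B : opnorm (A + B) <= opnorm A + opnorm B.
Proof.
apply: opnorm_le => x x1; rewrite bopD (le_trans (rnormD _ _))//.
by rewrite lerD// opnorm_unit.
Qed.

Lemma opnormZ_le k A : opnorm (k *: A) <= complex.Re `|k| * opnorm A.
Proof.
apply: opnorm_le => x x1; rewrite bopZ -lecR rnormE normrZ.
rewrite real_complexM re_normE -rnormE.
by rewrite ler_wpM2l// lecR opnorm_unit.
Qed.

(* The operator norm, in R[i] as normed modules over R[i] require. *)
Definition bop_norm (A : bop) : R[i] := (opnorm A)%:C.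

Lemma bop_normD A B : bop_norm (A + B) <= bop_norm A + bop_norm B.
Proof. by rewrite /bop_norm -rmorphD/= lecR opnormD. Qed.

Lemma bop_normZ k A : bop_norm (k *: A) = `|k| * bop_norm A.
Proof.
have leZ c B : bop_norm (c *: B) <= `|c| * bop_norm B.
  have := opnormZ_le c B; by rewrite -lecR real_complexM re_normE.
apply/eqP; rewrite eq_le leZ/=.
have [->|k0] := eqVneq k 0; first by rewrite normr0 mul0r lecR opnorm_ge0.
rewrite -ler_pdivlMl ?normr_gt0//.
have {1}-> : A = k^-1 *: (k *: A) by rewrite scalerA mulVf// scale1r.
by rewrite -normfV leZ.
Qed.

Lemma bop_norm0_eq0 A : bop_norm A = 0 -> A = 0.
Proof.
move=> /complexI A0; apply/val_inj/funext => x /=.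
apply/normr0_eq0/eqP; rewrite eq_le normr_ge0 andbT -rnormE lecR.
by rewrite (le_trans (opnorm_bound A x))// A0 mul0r.
Qed.

HB.instance Definition _ :=
  Lmodule_isNormed.Build R[i] bop bop_normD bop_normZ bop_norm0_eq0.

End bounded_operators.

Notation "''B' ( V , W )" := (bop V W) : type_scope.
Notation "''B' ( V )" := (bop V V) : type_scope.

Section composition.
Variables (R : realType).
Implicit Types U V W : normedModType R[i].

Lemma is_bop_comp U V W (A : 'B(V, W)) (B : 'B(U, V)) :
  (A \o B : U -> W) \in @is_bop R U W.
Proof.
apply/asboolP; split; first by move=> k x y; rewrite /= !linearP.
by move=> x; apply: continuous_comp; exact: bop_continuous.
Qed.

Definition bop_comp U V W (A : 'B(V, W)) (B : 'B(U, V)) : 'B(U, W) :=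
  Bop (is_bop_comp A B).

Lemma is_bop_id V : (id : V -> V) \in @is_bop R V V.
Proof. by apply/asboolP; split=> // x; exact: cvg_id. Qed.

Definition bop_id V : 'B(V) := Bop (is_bop_id V).

End composition.

Section operator_ring.
Variables (R : realType) (V : normedModType R[i]).
Implicit Types A B C : 'B(V).

Let mul A B : 'B(V) := bop_comp A B.

Let mulA : associative mul.
Proof. by move=> A B C; apply/val_inj. Qed.

Let mul1 : left_id (bop_id V) mul.
Proof. by move=> A; apply/val_inj. Qed.

Let mulr1 : right_id (bop_id V) mul.
Proof. by move=> A; apply/val_inj. Qed.

Let mulDl : left_distributive mul +%R.
Proof. by move=> A B C; apply/val_inj. Qed.

Let mulDr : right_distributive mul +%R.
Proof. by move=> A B C; apply/val_inj/funext => x /=; rewrite linearD. Qed.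

HB.instance Definition _ :=
  GRing.Zmodule_isPzRing.Build 'B(V) mulA mul1 mulr1 mulDl mulDr.

End operator_ring.

Section subspaces.
Variables (R : realType) (V : normedModType R[i]).

Record closed_subspace := ClosedSubspace {
  cs_pred : {pred V};
  cs_submod : GRing.submod_closed cs_pred;
  cs_closed : closed [set` cs_pred] }.

HB.instance Definition _ (M : closed_subspace) :=
  GRing.isSubmodClosed.Build R[i] V (cs_pred M) (cs_submod M).

(* A closed subspace as a space in its own right. *)
Record subsp (M : closed_subspace) :=
  Subsp { subsp_val : V; subspP : subsp_val \in cs_pred M }.

HB.instance Definition _ M := [isSub for @subsp_val M].
HB.instance Definition _ M := [Choice of subsp M by <:].
HB.instance Definition _ M := [SubChoice_isSubLmodule of subsp M by <:].

Section norm.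
Variable M : closed_subspace.
Implicit Types x y : subsp M.

Definition subsp_norm x : R[i] := `|subsp_val x|.

Lemma subsp_normD x y : subsp_norm (x + y) <= subsp_norm x + subsp_norm y.
Proof. exact: ler_normD. Qed.

Lemma subsp_normZ k x : subsp_norm (k *: x) = `|k| * subsp_norm x.
Proof. exact: normrZ. Qed.

Lemma subsp_norm0_eq0 x : subsp_norm x = 0 -> x = 0.
Proof. by move=> /normr0_eq0 x0; apply: val_inj. Qed.

HB.instance Definition _ := Lmodule_isNormed.Build R[i] (subsp M)
  subsp_normD subsp_normZ subsp_norm0_eq0.

Lemma subsp_val_linear : linear (@subsp_val M).
Proof. by []. Qed.

Lemma subsp_val_continuous : continuous (@subsp_val M).
Proof.
move=> x; have FF : Filter (nbhs x) by exact: nbhs_filter.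
apply/cvgrPdist_lt => e e0.
exact: (@cvgr_dist_lt _ _ _ (nbhs x) FF id x (@cvg_id _ (nbhs x)) e e0).
Qed.

Definition subsp_incl : 'B(subsp M, V) :=
  Bop (introT (asboolP _) (conj subsp_val_linear subsp_val_continuous)).

End norm.
End subspaces.

Section complete_subspaces.
Variables (R : realType) (V : completeNormedModType R[i]).
Variable M : closed_subspace V.

Lemma subsp_complete (F : set_system (subsp M)) :
  ProperFilter F -> cauchy F -> cvg F.
Proof.
move=> FF cF.
have cG : cauchy (@subsp_val _ _ M @ F).
  apply/cauchy_ballP => e e0.
  have /cauchy_ballP/(_ e e0)[[A B] /= [FA FB] AB] := cF.
  exists (@subsp_val _ _ M @` A, @subsp_val _ _ M @` B).
    by split; [apply: filterS FA|apply: filterS FB] => x ?; exists x.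
  move=> [_ _] [/= [x Ax <-] [y By <-]]; rewrite -ball_normE.
  have := AB (x, y) (conj Ax By); rewrite /= -ball_normE; exact.
have /cauchy_cvg Gl := cG.
have Ml : lim (@subsp_val _ _ M @ F) \in cs_pred M.
  apply: (closed_cvg _ (@cs_closed _ _ M) _ _ Gl).
  by apply: nearW => x; exact: subspP.
apply/cvg_ex; exists (Subsp Ml).
apply/cvgrPdist_lt => e e0.
by move/cvgrPdist_lt : Gl => /(_ e e0).
Qed.

HB.instance Definition _ := Uniform_isComplete.Build (subsp M) subsp_complete.

End complete_subspaces.

Section hilbert_subspaces.
Variables (R : realType) (H : hilbertType R) (M : closed_subspace H).
Implicit Types x y z : subsp M.

Definition subsp_dot x y : R[i] := '[subsp_val x, subsp_val y].

Lemma subsp_dot_bilinear :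
  bilinear_for *%R (@Num.conj R[i] \; *%R) subsp_dot.
Proof.
split=> [y k x z|x k y z]; rewrite /subsp_dot.
  exact: linearPl.
exact: linearPr.
Qed.

HB.instance Definition _ := @bilinear_isBilinear.Build R[i]
  (subsp M) (subsp M) R[i] _ _ subsp_dot subsp_dot_bilinear.

Lemma subsp_dot_hermitian x y :
  subsp_dot x y = (-1) ^+ false * Num.conj (subsp_dot y x).
Proof. exact: hermC. Qed.

HB.instance Definition _ := isHermitianSesquilinear.Build R[i] (subsp M)
  false (@Num.conj R[i]) subsp_dot subsp_dot_hermitian.

Lemma subsp_dot_gt0 x : x != 0 -> 0 < subsp_dot x x.
Proof.
move=> x0; apply: neq0_dnorm_gt0; apply: contra x0 => /eqP x0.
by apply/eqP/val_inj.
Qed.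

HB.instance Definition _ :=
  isDotProduct.Build R[i] (subsp M) subsp_dot subsp_dot_gt0.

Lemma sqr_subsp_normE x : `|x| ^+ 2 = subsp_dot x x.
Proof. exact: sqr_normE. Qed.

HB.instance Definition _ :=
  NormedModule_isHilbert.Build R (subsp M) sqr_subsp_normE.

End hilbert_subspaces.

Section hilbert_operators.
Variable R : realType.
Implicit Types (H K : hilbertType R) (V : normedModType R[i]).

(* [adj], [proj] and [tensor_op] below select the operator determined by its
   defining property; 0 is only the default of the choice operator. *)
Definition adj H K (A : 'B(H, K)) : 'B(K, H) :=
  xget 0 [set B : 'B(K, H) | forall x y, '[A x, y] = '[x, B y]].

(* Over R[i], [0 <= z] says that z is real and nonnegative, so a positive
   operator is self-adjoint. *)
Definition psd H (A : 'B(H)) := forall x, 0 <= '[A x, x].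

Definition op_le H (A B : 'B(H)) := psd (B - A).

Definition invertible H (A : 'B(H)) :=
  exists B : 'B(H), B * A = 1 /\ A * B = 1.

Definition wot_cvg H (A_ : nat -> 'B(H)) (A : 'B(H)) := forall x y,
  (fun m => '[A_ m x, y] : R[i]^o) @ \oo --> ('[A x, y] : R[i]^o).

Definition wot_series H (A_ : nat -> 'B(H)) (A : 'B(H)) :=
  wot_cvg (fun m => \sum_(k < m) A_ k) A.

(* The orthogonal projection onto M, with codomain M. *)
Definition proj H (M : closed_subspace H) : 'B(H, subsp M) :=
  xget 0 [set P : 'B(H, subsp M) |
    forall x (y : subsp M), '[x - subsp_incl M (P x), subsp_incl M y] = 0].

Definition compression H (M : closed_subspace H) (A : 'B(H)) : 'B(subsp M) :=
  bop_comp (proj M) (bop_comp A (subsp_incl M)).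

Definition jointly_similar H K n (T : 'I_n -> 'B(H)) (A : 'I_n -> 'B(K)) :=
  exists (X : 'B(H, K)) (Y : 'B(K, H)),
    [/\ bop_comp Y X = bop_id H, bop_comp X Y = bop_id K &
        forall i, T i = bop_comp Y (bop_comp (A i) X)].

Definition in_closed_span V (S : set V) (x : V) :=
  forall M : closed_subspace V, S `<=` [set` cs_pred M] -> x \in cs_pred M.

Definition orthonormal_basis (I : eqType) H (e : I -> H) :=
  (forall i j, '[e i, e j] = (i == j)%:R) /\
  (forall x, in_closed_span (range e) x).

(* (G, t) is a Hilbert space tensor product of H and K, with
   t x y standing for the elementary tensor of x and y. *)
Definition hilbert_tensor H K (G : hilbertType R)
    (t : {bilinear H -> K -> G}) :=
  (forall x x' y y', '[t x y, t x' y'] = '[x, x'] * '[y, y']) /\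
  (forall z, in_closed_span [set t x y | x in setT & y in setT] z).

Definition tensor_op H K (G : hilbertType R) (t : {bilinear H -> K -> G})
    (A : 'B(H)) (B : 'B(K)) : 'B(G) :=
  xget 0 [set C : 'B(G) | forall x y, C (t x y) = t (A x) (B y)].

End hilbert_operators.

Section free_semigroup.
Variables (R : realType) (n : nat).

(* The free unital semigroup on n generators is [seq 'I_n]: g_0 is [::], the
   length is [size] and g_i alpha is [i :: alpha]. *)

(* mu(alpha, g_0), the product of mu over the nonempty suffixes of alpha. *)
Definition weight_prod (mu : seq 'I_n -> R) (w : seq 'I_n) : R :=
  \prod_(j < size w) mu (drop j w).

Definition is_weighted_shift (mu : seq 'I_n -> R) (F : hilbertType R)
    (e : seq 'I_n -> F) (W : 'I_n -> 'B(F)) :=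
  forall i w, W i (e w) = (mu (i :: w))%:C *: e (i :: w).

Section tuples.
Variables (H : hilbertType R) (T : 'I_n -> 'B(H)).

Definition word_op (w : seq 'I_n) : 'B(H) := \prod_(i <- w) T i.

Definition joint_spectral_radius : R :=
  lim ((fun k : nat => powR
    (rnorm (\sum_(w : k.-tuple 'I_n) word_op w * adj (word_op w)))
    (2 * k)%:R^-1) @ \oo).

(* A noncommutative polynomial is a finitely supported family of coefficients
   indexed by words. *)
Definition nc_eval (p : {malg R[i][seq 'I_n]}) : 'B(H) :=
  \sum_(w <- msupp p) p@_w *: word_op w.

Definition closed_algebra_containing (S : {pred 'B(H)}) :=
  [/\ GRing.submod_closed S, GRing.mulr_closed S, closed [set` S] &
      forall i, T i \in S].

Definition alg_pred : {pred 'B(H)} :=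
  fun A => `[< forall S, closed_algebra_containing S -> A \in S >].

Lemma alg_submod : GRing.submod_closed alg_pred.
Proof.
split; first by apply/asboolP => S [[]].
move=> k A B /asboolP SA /asboolP SB; apply/asboolP => S hS.
have [[_ SD] _ _ _] := hS; exact: SD (SA S hS) (SB S hS).
Qed.

Lemma alg_closed : closed [set` alg_pred].
Proof.
move=> A clA; apply/asboolP => S hS; have [_ _ clS _] := hS.
by apply: clS; apply: closureS clA => B /= /asboolP/(_ S hS).
Qed.

(* The norm-closed unital algebra generated by T_1, ..., T_n, i.e. the least
   one containing them. *)
Definition closed_algebra : closed_subspace 'B(H) :=
  ClosedSubspace alg_submod alg_closed.

End tuples.
End free_semigroup.

Section completely_bounded.
Variable R : realType.

(* The norm of a matrix of operators acting on V^k with the l^2 norm. *)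
Definition mx_opnorm (V W : normedModType R[i]) k (A : 'M['B(V, W)]_k) : R :=
  sup [set Num.sqrt (\sum_i rnorm (\sum_j A i j (x j)) ^+ 2)
      | x in [set x : 'I_k -> V | \sum_j rnorm (x j) ^+ 2 <= 1]].

Definition cb_norm (H K : hilbertType R) (S : closed_subspace 'B(H))
    (Phi : {linear subsp S -> 'B(K)}) : \bar R :=
  ereal_sup [set y | exists k (A : 'M[subsp S]_k),
    mx_opnorm (map_mx (@subsp_val _ _ S) A) <= 1 /\
    y = (mx_opnorm (map_mx Phi A))%:E].

Definition completely_bounded (H K : hilbertType R) (S : closed_subspace 'B(H))
    (Phi : {linear subsp S -> 'B(K)}) := (cb_norm Phi < +oo)%E.

End completely_bounded.

(* Main.v *)
(* Write Q = L^* L. The Poisson-type kernel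
     K h = sum_w mu(w, g_0)^-1 e_w (x) L T_w^* h
   satisfies |K h|^2 = <S h, h>, so a |h|^2 <= |K h|^2 <= b |h|^2, and it
   intertwines K T_i^* = (W_i^* (x) I) K.  Hence its range M is closed and
   invariant, and K^*, restricted to M, implements the similarity.  With J a right
   inverse of K^* of norm at most a^(-1/2), the functional calculus is
   Phi A = K^* (A (x) I) J, because p(T) K^* = K^* (p(W) (x) I); this gives
   |Phi|_cb <= |K^*| |J| <= sqrt (b / a).  The same intertwining bounds
   |sum_(|w| = k) T_w T_w^*| by b / a times the corresponding norm for W, and the
   factor b / a disappears after taking 2k-th roots. *)
Require Import Defs.
From HB Require Import structures.
From mathcomp Require Import all_boot all_order all_algebra.
From mathcomp Require Import finmap monalg.
From mathcomp Require Import all_classical all_reals all_analysis.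
From mathcomp Require Import complex.
From mathcomp Require Import ring lra.

Set Implicit Arguments.
Unset Strict Implicit.
Unset Printing Implicit Defensive.

Import Order.TTheory GRing.Theory Num.Theory numFieldNormedType.Exports.
Local Open Scope classical_set_scope.
Local Open Scope complex_scope.
Local Open Scope ring_scope.

(** * Bounded operators *)

(** Adjoints, projections, [A (x) I] and the limit in the spectral radius are given by total
    operators with a default value, so nothing can be said of them before existence is proved: hence
    the Riesz representation, the explicit construction of [A (x) I] and Fekete's lemma. Moreover
    [H] is arbitrary, possibly nonseparable, and the tensor product is known only through its inner
    product and the totality of elementary tensors. Coordinates are therefore taken along the basis
    [e] of [F], exhausted by the words of length less than [m], and the second factor only ever
    meets finite orthonormal families. Of the root [L] only [|L x|^2 = <Q x, x>] is retained;
    invertibility of [Q] bounds it below, which makes the iteration for [L] a strict contraction. *)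

Section real_norm.
Variables (R : realType) (V : normedModType R[i]).
Implicit Types (x y : V) (u : nat -> V).

Lemma rnorm0 : rnorm (0 : V) = 0.
Proof. by rewrite /rnorm normr0. Qed.

Lemma rnormN x : rnorm (- x) = rnorm x.
Proof. by rewrite /rnorm normrN. Qed.

Lemma rnormBC x y : rnorm (x - y) = rnorm (y - x).
Proof. by rewrite -rnormN opprB. Qed.

Lemma rnorm_eq0 x : rnorm x = 0 -> x = 0.
Proof. by move=> x0; apply: normr0_eq0; rewrite -rnormE x0. Qed.

Lemma rnorm_sum I (r : seq I) (f : I -> V) :
  rnorm (\sum_(i <- r) f i) <= \sum_(i <- r) rnorm (f i).
Proof.
elim: r => [|i r IH]; first by rewrite !big_nil rnorm0.
by rewrite !big_cons (le_trans (rnormD _ _))// lerD2l.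
Qed.

Lemma ler_rnormB x y : rnorm x - rnorm y <= rnorm (x - y).
Proof. by rewrite lerBlDr -{1}(subrK y x) rnormD. Qed.

Lemma rnorm_distD y x z : rnorm (x - z) <= rnorm (x - y) + rnorm (y - z).
Proof. by rewrite -(subrKA y) rnormD. Qed.

(** Norms take values in [R[i]]; this moves convergence to real sequences, where all order arguments
    are carried out. *)
Lemma rcvgP u l : u @ \oo --> l <-> rnorm (l - u m) @[m --> \oo] --> (0 : R).
Proof.
split=> [/cvgrPdist_lt ul|/cvgrPdist_lt ul]; apply/cvgrPdist_lt => e e0.
  have /ul : 0 < e%:C by rewrite ltcR.
  apply: filterS => m; rewrite -rnormE ltcR sub0r normrN ger0_norm//.
  exact: rnorm_ge0.
have eE : (complex.Re e)%:C = e by rewrite RRe_real// gtr0_real.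
have /ul : 0 < complex.Re e by rewrite -ltcR eE.
apply: filterS => m; rewrite sub0r normrN ger0_norm ?rnorm_ge0// => h.
by rewrite -rnormE -eE ltcR.
Qed.

Lemma rcvg_squeeze u l (a : nat -> R) :
  (forall m, rnorm (l - u m) <= a m) -> a @ \oo --> (0 : R) -> u @ \oo --> l.
Proof.
move=> ua a0; apply/rcvgP; apply: (squeeze_cvgr _ (cvg_cst _) a0).
by apply: nearW => m; rewrite rnorm_ge0 ua.
Qed.

Lemma rcvg_rnorm u l : u @ \oo --> l -> rnorm (u m) @[m --> \oo] --> rnorm l.
Proof.
move=> /rcvgP/cvgrPdist_lt ul; apply/cvgrPdist_lt => e /ul.
apply: filterS => m; rewrite sub0r normrN; apply: le_lt_trans.
rewrite [leRHS]ger0_norm ?rnorm_ge0// ler_norml lerNl opprB.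
by rewrite ler_rnormB rnormBC ler_rnormB.
Qed.

Lemma rcvg_sqr_rnorm u l :
  u @ \oo --> l -> rnorm (u m) ^+ 2 @[m --> \oo] --> rnorm l ^+ 2.
Proof.
by move=> /rcvg_rnorm ul; rewrite expr2; under eq_fun do rewrite expr2; apply: cvgM.
Qed.

Lemma closure_rcvgP (A : set V) x :
  closure A x <-> exists u, (forall m, A (u m)) /\ u @ \oo --> x.
Proof.
split=> [clx|[u [Au ux]]]; last first.
  apply: (closed_cvg _ (@closed_closure _ A) _ _ ux).
  by apply: nearW => m; apply: subset_closure; exact: Au.
have /choice[u Au] : forall m : nat, exists y, A y /\ rnorm (x - y) <= m.+1%:R^-1.
  move=> m; have [|y [Ay]] := clx (ball x m.+1%:R^-1%:C).
    by apply: nbhsx_ballx; rewrite ltcR invr_gt0.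
  by rewrite -ball_normE /= -rnormE ltcR => /ltW xy; exists y.
exists u; split=> [m|]; first by case: (Au m).
apply: (@rcvg_squeeze _ _ (fun m => m.+1%:R^-1)); last exact: cvg_harmonic.
by move=> m; case: (Au m).
Qed.

Lemma closed_rcvgP (A : set V) :
  closed A <-> forall u l, (forall m, A (u m)) -> u @ \oo --> l -> A l.
Proof.
split=> [cA u l Au ul|h x /closure_rcvgP[u [Au ux]]]; last exact: (h u).
by apply: (closed_cvg _ cA _ _ ul); exact: nearW.
Qed.

End real_norm.

Lemma rcauchy_cvg (R : realType) (V : completeNormedModType R[i])
    (u : nat -> V) :
  (forall e : R, 0 < e -> exists N, forall m, (N <= m)%N ->
     rnorm (u m - u N) < e) -> exists l : V, u @ \oo --> l.
Proof.
move=> uC; have /cauchy_cvg ul : cauchy (u @ \oo).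
  apply/cauchy_exP => e e0.
  have eE : (complex.Re e)%:C = e by rewrite RRe_real// gtr0_real.
  have /uC[N uN] : 0 < complex.Re e by rewrite -ltcR eE.
  exists (u N); exists N => // m /= /uN.
  by rewrite -ball_normE/= distrC -rnormE -eE ltcR.
by exists (lim (u @ \oo)).
Qed.

Lemma geometric_rcvg (R : realType) (V : completeNormedModType R[i])
    (u : nat -> V) (C q : R) : 0 <= q < 1 ->
  (forall m, rnorm (u m.+1 - u m) <= C * q ^+ m) -> exists l : V, u @ \oo --> l.
Proof.
move=> /andP[q0 q1] uq.
have Cge0 : 0 <= C by have := uq 0; rewrite expr0 mulr1; apply: le_trans; exact: rnorm_ge0.
(* The geometric sum in closed form, so that the induction on [p] is an identity. *)
have tail N p : rnorm (u (N + p)%N - u N) <= C / (1 - q) * q ^+ N * (1 - q ^+ p).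
  elim: p => [|p IH]; first by rewrite addn0 !subrr rnorm0 mulr0.
  rewrite addnS (le_trans (rnorm_distD (u (N + p)%N) _ _))//.
  rewrite (le_trans (lerD (uq _) IH))// exprD exprS le_eqVlt; apply/orP; left.
  by apply/eqP; field; rewrite subr_eq0 gt_eqF.
apply: rcauchy_cvg => e e0.
have : geometric (C / (1 - q)) q @ \oo --> (0 : R).
  by apply: cvg_geometric; rewrite ger0_norm.
move=> /cvgrPdist_lt/(_ _ e0)[N _ /(_ N (leqnn N))].
rewrite /= sub0r normrN ger0_norm => [Ne|]; last first.
  by rewrite mulr_ge0 ?divr_ge0 ?exprn_ge0// subr_ge0 ltW.
exists N => m /subnKC <-; apply: le_lt_trans (tail _ _) _.
apply: le_lt_trans Ne; rewrite ler_piMr ?lerBlDl ?lerDr ?exprn_ge0//.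
by rewrite mulr_ge0 ?divr_ge0 ?exprn_ge0// subr_ge0 ltW.
Qed.

Section bounded_operators.
Variables (R : realType) (V W : normedModType R[i]).
Implicit Types A B : 'B(V, W).

(** Every operator defined below by a formula becomes an element of ['B(V, W)] through this
    criterion. *)
Lemma bounded_linear_bop (f : V -> W) (C : R) :
  linear f -> (forall x, rnorm (f x) <= C * rnorm x) ->
  exists A : 'B(V, W), A =1 f.
Proof.
move=> lf fC.
pose g : {linear V -> W} := HB.pack f (GRing.isLinear.Build _ _ _ _ f lf).
have cf : continuous f.
  apply/(linear_bounded_continuous g)/linear_boundedP.
  exists C%:C; split; first by apply/complex_realP; exists C.
  move=> r Cr x; apply: le_trans (_ : C%:C * `|x| <= _); last first.
    by rewrite ler_wpM2r ?normr_ge0// ltW.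
  by rewrite -!rnormE -real_complexM lecR.
by exists (Bop (introT (asboolP _) (conj lf cf))).
Qed.

Lemma bop_cvg A (u : nat -> V) l : u @ \oo --> l -> A (u m) @[m --> \oo] --> A l.
Proof. by move=> ul; apply: continuous_cvg ul; exact: bop_continuous. Qed.

Lemma opnorm_bounded A (C : R) : 0 <= C ->
  (forall x, rnorm (A x) <= C * rnorm x) -> opnorm A <= C.
Proof.
move=> Cge0 leC; apply: opnorm_le => x x1; rewrite (le_trans (leC x))//.
by rewrite ler_piMr.
Qed.

Lemma rnorm_bop A : rnorm A = opnorm A.
Proof. by []. Qed.

Lemma bop_sum I (r : seq I) (F : I -> 'B(V, W)) x :
  (\sum_(i <- r) F i) x = \sum_(i <- r) F i x.
Proof. by elim/big_rec2: _ => // i _ A _ <-. Qed.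

Lemma bop_sumr I (r : seq I) A (f : I -> V) :
  A (\sum_(i <- r) f i) = \sum_(i <- r) A (f i).
Proof. exact: linear_sum. Qed.

Lemma bop_subr A x y : A (x - y) = A x - A y.
Proof. exact: linearB. Qed.

Lemma bopB A B x : (A - B) x = A x - B x. Proof. by []. Qed.

Lemma bop_ext A B : A =1 B -> A = B.
Proof. by move=> AB; apply/val_inj/funext. Qed.

End bounded_operators.

Lemma bopM (R : realType) (V : normedModType R[i]) (A B : 'B(V)) x :
  (A * B) x = A (B x).
Proof. by []. Qed.

Lemma opnorm_mul (R : realType) (V : normedModType R[i]) (A B : 'B(V)) :
  opnorm (A * B) <= opnorm A * opnorm B.
Proof.
apply: opnorm_bounded => [|x]; first by rewrite mulr_ge0 ?opnorm_ge0.
rewrite -mulrA (le_trans (opnorm_bound A _))// ler_wpM2l ?opnorm_ge0//.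
exact: opnorm_bound.
Qed.

Lemma bopM_cvg (R : realType) (V : normedModType R[i]) (u v : nat -> 'B(V))
    (A B : 'B(V)) :
  u @ \oo --> A -> v @ \oo --> B -> u m * v m @[m --> \oo] --> A * B.
Proof.
move=> uA vB; have vn := rcvg_rnorm vB.
move/rcvgP: uA => uA; move/rcvgP: vB => vB.
apply: (@rcvg_squeeze _ _ _ _ (fun m =>
  opnorm A * rnorm (B - v m) + rnorm (A - u m) * rnorm (v m))).
  move=> m; have -> : A * B - u m * v m = A * (B - v m) + (A - u m) * v m.
    by rewrite mulrBr mulrBl subrKA.
  by rewrite (le_trans (rnormD _ _))// lerD// rnorm_bop opnorm_mul.
rewrite -[X in _ --> X]addr0; apply: cvgD.
  by rewrite -(mulr0 (opnorm A)); apply: cvgM => //; exact: cvg_cst.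
by rewrite -(mul0r (rnorm B)); apply: cvgM.
Qed.

(** Strong limits are the right notion here: the truncations of the Poisson kernel and of [A (x) I]
    need not converge in norm. The uniform bound passes to the limit and makes it continuous. *)
Lemma pointwise_limit_bop (R : realType) (V : normedModType R[i])
    (W : completeNormedModType R[i]) (A : nat -> 'B(V, W)) (C : R) :
  (forall x, exists y : W, A m x @[m --> \oo] --> y) ->
  (forall m x, rnorm (A m x) <= C * rnorm x) ->
  exists B : 'B(V, W), (forall x, A m x @[m --> \oo] --> B x) /\
    forall x, rnorm (B x) <= C * rnorm x.
Proof.
move=> /choice[f Af] leC.
have fC x : rnorm (f x) <= C * rnorm x.
  apply: (cvgr_to_le (rcvg_rnorm (Af x))); exact: nearW.
have lf : linear f.
  move=> k x y; have Afxy : A m (k *: x + y) @[m --> \oo] --> k *: f x + f y.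
    rewrite (_ : (fun m => _) = fun m => k *: A m x + A m y); last first.
      by apply/funext => m; rewrite linearP.
    by apply: cvgD => //; apply: cvgZr.
  by apply: cvg_unique (Af _) Afxy.
have [B BE] := bounded_linear_bop lf fC.
by exists B; split=> x; rewrite BE.
Qed.

(** * Hilbert spaces and adjoints *)

Lemma ReD (R : realType) (z w : R[i]) :
  complex.Re (z + w) = complex.Re z + complex.Re w.
Proof. by case: z w => [a b] [c d]. Qed.

Lemma ReN (R : realType) (z : R[i]) : complex.Re (- z) = - complex.Re z.
Proof. by case: z. Qed.

Lemma Re_sum (R : realType) I (r : seq I) (f : I -> R[i]) :
  complex.Re (\sum_(i <- r) f i) = \sum_(i <- r) complex.Re (f i).
Proof. exact: (big_morph _ (@ReD R) (erefl : complex.Re (0 : R[i]) = 0)). Qed.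

Lemma Re_realM (R : realType) (k : R) (z : R[i]) :
  complex.Re (k%:C * z) = k * complex.Re z.
Proof. by case: z => a b /=; rewrite mul0r subr0. Qed.

Lemma Re_conj (R : realType) (z : R[i]) :
  complex.Re (Num.conj z) = complex.Re z.
Proof. by case: z. Qed.

(** Common source of the Cauchy-Schwarz inequalities and of the vanishing first variation in the
    Riesz argument. *)
Lemma discriminant_le (R : realType) (a b c : R) :
  (forall t, 0 <= a + t * (2 * b) + t ^+ 2 * c) -> b ^+ 2 <= a * c.
Proof.
move=> h; have a0 : 0 <= a by have := h 0; rewrite mul0r expr0n/= mul0r !addr0.
have [c0|c0|c0] := ltgtP c 0.
(* [t >= 1] and [t * - c > a], so the values at [t] and [- t], whose linear terms cancel in the sum,
   cannot both be nonnegative. *)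
- exfalso; pose t := 1 + (a + 1) / (- c).
  have t1 : 1 <= t by rewrite lerDl divr_ge0 ?addr_ge0 ?oppr_ge0// ltW.
  have tc : t * - c = - c + a + 1 by rewrite /t; field; rewrite lt_eqF.
  have := h t; have := h (- t) => h1 h2.
  have : t * - c <= t ^+ 2 * - c.
    rewrite ler_wpM2r ?oppr_ge0 ?(ltW c0)// expr2 ler_pMl//.
    exact: lt_le_trans t1.
  by rewrite tc; move: h1 h2; rewrite sqrrN mulNr; lra.
- have := h (- b / c); have -> : a + - b / c * (2 * b) + (- b / c) ^+ 2 * c
    = (a * c - b ^+ 2) / c by field; rewrite gt_eqF.
  by rewrite pmulr_lge0 ?invr_gt0// subr_ge0.
- rewrite c0 mulr0; have [->|b0] := eqVneq b 0; first by rewrite expr0n.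
  have := h (- (a + 1) / (2 * b)).
  have -> : a + - (a + 1) / (2 * b) * (2 * b) + (- (a + 1) / (2 * b)) ^+ 2 * c = -1.
    by rewrite c0; field.
  by rewrite ler0N1.
Qed.

Section hilbert.
Variables (R : realType) (H : hilbertType R).
Implicit Types (x y z : H) (k : R[i]).

Lemma hdotC x y : '[y, x] = Num.conj '[x, y].
Proof. by rewrite hermC expr0 mul1r. Qed.

Lemma hdotDl x y z : '[x + y, z] = '[x, z] + '[y, z].
Proof. exact: linearDl. Qed.

Lemma hdotDr x y z : '[x, y + z] = '[x, y] + '[x, z].
Proof. exact: linearDr. Qed.

Lemma hdotZl k x y : '[k *: x, y] = k * '[x, y].
Proof. exact: linearZl_LR. Qed.

Lemma hdotZr k x y : '[x, k *: y] = Num.conj k * '[x, y].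
Proof. exact: linearZr_LR. Qed.

Lemma hdotBl x y z : '[x - y, z] = '[x, z] - '[y, z].
Proof. exact: linearBl. Qed.

Lemma hdot_suml I (r : seq I) (f : I -> H) x :
  '[\sum_(i <- r) f i, x] = \sum_(i <- r) '[f i, x].
Proof. exact: linear_sumlz. Qed.

Lemma hdot_sumr I (r : seq I) (f : I -> H) x :
  '[x, \sum_(i <- r) f i] = \sum_(i <- r) '[x, f i].
Proof. exact: linear_sumr. Qed.

Lemma hdotxx x : '[x, x] = (rnorm x ^+ 2)%:C.
Proof. by rewrite rmorphXn/= rnormE -sqr_normE. Qed.

(** [H] as a real Hilbert space; the imaginary part of the inner product is recovered by rotating
    the second argument by ['i]. *)
Definition rdot x y : R := complex.Re '[x, y].

Lemma rdotC x y : rdot x y = rdot y x.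
Proof. by rewrite /rdot hdotC Re_conj. Qed.

Lemma rdotDl x y z : rdot (x + y) z = rdot x z + rdot y z.
Proof. by rewrite /rdot linearDl ReD. Qed.

Lemma rdotDr x y z : rdot x (y + z) = rdot x y + rdot x z.
Proof. by rewrite /rdot linearDr ReD. Qed.

Lemma rdotNl x y : rdot (- x) y = - rdot x y.
Proof. by rewrite /rdot linearNl ReN. Qed.

Lemma rdotNr x y : rdot x (- y) = - rdot x y.
Proof. by rewrite /rdot linearNr ReN. Qed.

Lemma rdotZl (t : R) x y : rdot (t%:C *: x) y = t * rdot x y.
Proof. by rewrite /rdot hdotZl Re_realM. Qed.

Lemma rdotZr (t : R) x y : rdot x (t%:C *: y) = t * rdot x y.
Proof. by rewrite rdotC rdotZl rdotC. Qed.

Lemma rdotxx x : rdot x x = rnorm x ^+ 2.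
Proof. by rewrite /rdot hdotxx. Qed.

Lemma Im_hdot x y : complex.Im '[x, y] = rdot x ('i%C *: y).
Proof.
by rewrite /rdot hdotZr; case: '[x, y] => a b /=; rewrite mul0r sub0r mulN1r opprK.
Qed.

Lemma hdot_rdot x y : '[x, y] = rdot x y +i* rdot x ('i%C *: y).
Proof. by rewrite -Im_hdot /rdot; case: '[x, y]. Qed.

Lemma sqr_rnormD x y :
  rnorm (x + y) ^+ 2 = rnorm x ^+ 2 + 2 * rdot x y + rnorm y ^+ 2.
Proof. by rewrite -!rdotxx rdotDl !rdotDr (rdotC y x); ring. Qed.

Lemma sqr_rnormB x y :
  rnorm (x - y) ^+ 2 = rnorm x ^+ 2 - 2 * rdot x y + rnorm y ^+ 2.
Proof. by rewrite sqr_rnormD rdotNr rnormN mulrN. Qed.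

Lemma rdot_CauchySchwarz x y : `|rdot x y| <= rnorm x * rnorm y.
Proof.
rewrite -ler_sqr ?nnegrE ?mulr_ge0 ?rnorm_ge0// real_normK ?num_real// exprMn.
apply: discriminant_le => t.
have -> : rnorm x ^+ 2 + t * (2 * rdot x y) + t ^+ 2 * rnorm y ^+ 2 =
  rnorm (x + t%:C *: y) ^+ 2.
  rewrite sqr_rnormD rdotZr rnormZ exprMn real_normK ?num_real//; ring.
exact: sqr_ge0.
Qed.

Lemma rdot_ext x y : (forall z, rdot x z = rdot y z) -> x = y.
Proof.
move=> xy; apply/eqP; rewrite -subr_eq0; apply/eqP/rnorm_eq0/eqP.
by rewrite -(sqrf_eq0 (rnorm _)) -rdotxx rdotDl rdotNl xy subrr.
Qed.

Lemma hdot_ext x y : (forall z, '[x, z] = '[y, z]) -> x = y.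
Proof. by move=> xy; apply: rdot_ext => z; rewrite /rdot xy. Qed.

Lemma hdot_extr x y : (forall z, '[z, x] = '[z, y]) -> x = y.
Proof. by move=> xy; apply: hdot_ext => z; rewrite hdotC xy -hdotC. Qed.


Lemma rdot_cvg x (u : nat -> H) l :
  u @ \oo --> l -> rdot (u m) x @[m --> \oo] --> rdot l x.
Proof.
move=> /rcvgP ul; apply/cvgrPdist_lt => e e0.
have /cvgrPdist_lt/(_ _ e0) : rnorm (l - u m) * rnorm x @[m --> \oo] --> 0 * rnorm x.
  by apply: cvgM => //; exact: cvg_cst.
apply: filterS => m; rewrite mul0r sub0r normrN => /(le_lt_trans _); apply.
rewrite -rdotNl -rdotDl (le_trans (rdot_CauchySchwarz _ _))//.
by rewrite ler_norm.
Qed.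

Lemma parallelogram x y :
  rnorm (x + y) ^+ 2 + rnorm (x - y) ^+ 2 = 2 * rnorm x ^+ 2 + 2 * rnorm y ^+ 2.
Proof. by rewrite sqr_rnormB sqr_rnormD; ring. Qed.

(* The representing vector minimises [|x|^2 - 2 Re (f x)]; a minimising sequence
   is Cauchy by the parallelogram law. *)
Lemma riesz_representation (f : H -> R[i]) (C : R) :
  (forall k x y, f (k *: x + y) = k * f x + f y) ->
  (forall x, `|complex.Re (f x)| <= C * rnorm x) ->
  exists z, forall x, f x = '[x, z].
Proof.
move=> lf fC.
have f0 : f 0 = 0.
  by have := lf (-1) 0 0; rewrite scaler0 addr0 mulN1r addNr.
pose g x := complex.Re (f x).
have gD x y : g (x + y) = g x + g y.
  by rewrite /g -{1}(scale1r x) lf mul1r ReD.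
have gZ (t : R) x : g (t%:C *: x) = t * g x.
  by rewrite /g -(addr0 (_ *: x)) lf f0 addr0 Re_realM.
(* A complex-linear [f] is determined by its real part: [Im (f x) = - g (i x)]. *)
suff [z gz] : exists z, forall x, g x = rdot x z.
  exists z => x; rewrite hdotC hdot_rdot.
  rewrite rdotC -gz rdotC -gz /g.
  rewrite -(addr0 ('i%C *: x)) lf.
  by rewrite f0 addr0; case: (f x) => a b; apply/eqP; rewrite eq_complex /= !(mul0r, sub0r, mul1r, opprK) !eqxx.
pose phi x := rnorm x ^+ 2 - 2 * g x.
have phi_lb x : - C ^+ 2 <= phi x.
  have := fC x; have := ler_norm (g x); rewrite /phi -/(g x).
  by have := sqr_ge0 (rnorm x - C); rewrite sqrrB; nra.
have hinf : has_inf (range phi).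
  by split; [exists (phi 0), 0|exists (- C ^+ 2) => _ [x _ <-]].
pose d := inf (range phi).
have dphi x : d <= phi x by apply: ge_inf; [case: hinf|exists x].
have phiD x y : rnorm (x - y) ^+ 2 = 2 * phi x + 2 * phi y - 4 * phi ((1/2)%:C *: (x + y)).
  have := parallelogram x y.
  rewrite /phi gZ gD rnormZ ger0_norm// exprMn; lra.
have /choice[u uphi] : forall m : nat, exists x, phi x < d + m.+1%:R^-1.
  move=> m; have m0 : 0 < m.+1%:R^-1 :> R by rewrite invr_gt0.
  by have [_ [x _ <-] ?] := inf_adherent m0 hinf; exists x.
have [z uz] : exists z, u @ \oo --> z.
  apply: rcauchy_cvg => e e0.
  (* The linear terms cancel in [phiD], and the midpoint value is at least [d]; hence [|x - y|^2 <=
     2 (phi x - d) + 2 (phi y - d)], less than [4 (e^2 / 4)] on the tail. *)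
  have e4 : 0 < e ^+ 2 / 4 by rewrite divr_gt0 ?exprn_gt0.
  have /cvgrPdist_lt/(_ _ e4)[N _ Ne] := @cvg_harmonic R.
  exists N => m Nm; rewrite -ltr_sqr ?nnegrE ?rnorm_ge0 ?ltW// phiD.
  have := dphi ((1/2)%:C *: (u m + u N)); have := uphi m; have := uphi N.
  have := Ne _ Nm; have := Ne _ (leqnn N).
  rewrite /harmonic /= !sub0r !normrN !ger0_norm ?invr_ge0//.
  move: (phi (u N)) (phi (u m)) (phi _) (d) N.+1%:R^-1 m.+1%:R^-1.
  by move=> pN pm p d' a b; lra.
have zd : phi z = d.
  apply/eqP; rewrite eq_le dphi andbT.
  have gcvg : g (u m) @[m --> \oo] --> g z.
    apply/cvgrPdist_lt => e e0.
    have /rcvgP uz0 := uz.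
    have /cvgrPdist_lt/(_ _ e0) : C * rnorm (z - u m) @[m --> \oo] --> C * 0.
      by apply: cvgM => //; exact: cvg_cst.
    apply: filterS => m; rewrite mulr0 sub0r normrN => /(le_lt_trans _); apply.
    have -> : g z - g (u m) = g (z - u m).
      by apply/eqP; rewrite subr_eq -gD subrK.
    by rewrite (le_trans (fC _))// ler_norm.
  have phicvg : phi (u m) @[m --> \oo] --> phi z.
    apply: cvgB; last by apply: cvgM => //; exact: cvg_cst.
    exact: rcvg_sqr_rnorm.
  have dcvg : d + m.+1%:R^-1 @[m --> \oo] --> d + 0.
    by apply: cvgD; [exact: cvg_cst|exact: cvg_harmonic].
  rewrite -[d in leRHS]addr0; apply: (ler_cvg_to phicvg dcvg).
  by apply: nearW => m; exact: ltW.
exists z => x; have [t] : exists t, t = g x - rdot x z by eexists.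
move=> tE; apply/eqP; rewrite -subr_eq0 -tE -sqrf_eq0 eq_le sqr_ge0 andbT.
apply: le_trans (_ : 0 * rnorm x ^+ 2 <= 0); last by rewrite mul0r.
(* First variation: minimality of [z] makes [phi (z - s x) - phi z = 2 s t + s^2 |x|^2] nonnegative
   for every real [s], which forces [t = 0]. *)
apply: discriminant_le => s; rewrite add0r.
have := dphi (z - s%:C *: x); rewrite -zd /phi.
have -> : g (z - s%:C *: x) = g z - s * g x.
  by rewrite gD -scaleN1r -(rmorphN1 (real_complex R)) gZ gZ mulN1r.
rewrite sqr_rnormB rnormZ exprMn real_normK ?num_real// rdotZr (rdotC z x) tE; lra.
Qed.

End hilbert.

Section adjoint.
Variables (R : realType).
Implicit Types (H K : hilbertType R).

(** Riesz representation of [x |-> <A x, y>]. The bound on the representing vector [f y] comes from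
    [|f y|^2 = Re <A (f y), y> <= |A| |f y| |y|]. *)
Lemma adj_exists H K (A : 'B(H, K)) :
  exists B : 'B(K, H), forall x y, '[A x, y] = '[x, B y].
Proof.
have /choice[f fE] : forall y, exists z, forall x, '[A x, y] = '[x, z].
  move=> y.
  apply: (@riesz_representation _ _ _ (opnorm A * rnorm y)) => [k u v|x].
    by rewrite linearP hdotDl hdotZl.
  rewrite (le_trans (rdot_CauchySchwarz _ _))// mulrAC ler_wpM2r ?rnorm_ge0//.
  exact: opnorm_bound.
have lf : linear f.
  move=> k u v; apply: hdot_extr => x.
  by rewrite -fE !hdotDr !hdotZr !fE.
have bf y : rnorm (f y) <= opnorm A * rnorm y.
  have [->|] := eqVneq (rnorm (f y)) 0; first by rewrite mulr_ge0 ?opnorm_ge0 ?rnorm_ge0.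
  move=> fy0; have fy : 0 < rnorm (f y) by rewrite lt_def fy0 rnorm_ge0.
  rewrite -(ler_pM2l fy) -expr2 -rdotxx /rdot -fE -/(rdot _ _).
  rewrite (le_trans (ler_norm _))// (le_trans (rdot_CauchySchwarz _ _))//.
  by rewrite mulrA ler_wpM2r ?rnorm_ge0// mulrC opnorm_bound.
have [B BE] := bounded_linear_bop lf bf.
by exists B => x y; rewrite BE fE.
Qed.

Lemma adjP H K (A : 'B(H, K)) x y : '[A x, y] = '[x, adj A y].
Proof.
move: x y; apply: (@xgetPex _ 0 [set B : 'B(K, H) | forall x y, '[A x, y] = '[x, B y]]).
exact: adj_exists.
Qed.

Lemma rdot_adj H K (A : 'B(H, K)) x y : rdot (A x) y = rdot x (adj A y).
Proof. by rewrite /rdot adjP. Qed.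

Lemma adj_unique H K (A : 'B(H, K)) (B : 'B(K, H)) :
  (forall x y, '[A x, y] = '[x, B y]) -> adj A = B.
Proof.
by move=> AB; apply: bop_ext => y; apply: hdot_extr => x; rewrite -adjP AB.
Qed.

Lemma adjK H K (A : 'B(H, K)) : adj (adj A) = A.
Proof.
by apply: adj_unique => x y; rewrite hdotC -adjP -hdotC.
Qed.

Lemma adjPr H K (A : 'B(H, K)) x y : '[x, A y] = '[adj A x, y].
Proof. by rewrite adjP adjK. Qed.

Lemma adj_comp H K (L : hilbertType R) (A : 'B(K, L)) (B : 'B(H, K)) :
  adj (bop_comp A B) = bop_comp (adj B) (adj A).
Proof. by apply: adj_unique => x y /=; rewrite !adjP. Qed.

Lemma adj1 H : adj (1 : 'B(H)) = 1.
Proof. exact: adj_unique. Qed.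

Lemma adj_bounded H K (A : 'B(H, K)) (C : R) : 0 <= C ->
  (forall x, rnorm (A x) <= C * rnorm x) ->
  forall y, rnorm (adj A y) <= C * rnorm y.
Proof.
move=> Cge0 leC y.
have [->|] := eqVneq (rnorm (adj A y)) 0; first by rewrite mulr_ge0 ?rnorm_ge0.
move=> fy0; have fy : 0 < rnorm (adj A y) by rewrite lt_def fy0 rnorm_ge0.
rewrite -(ler_pM2l fy) -expr2 -rdotxx -rdot_adj.
rewrite (le_trans (ler_norm _))// (le_trans (rdot_CauchySchwarz _ _))//.
by rewrite mulrA ler_wpM2r ?rnorm_ge0// mulrC leC.
Qed.

End adjoint.

(** * Positive operators *)

Section positive_operators.
Variables (R : realType) (H : hilbertType R).
Implicit Types (A Q : 'B(H)) (x y : H).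

Lemma rdot_ii x y : rdot ('i%C *: x) ('i%C *: y) = rdot x y.
Proof.
rewrite /rdot hdotZl hdotZr; case: '[x, y] => a b /=.
by rewrite !(mul0r, mulN1r, sub0r, addr0, mul1r, add0r, opprK).
Qed.

(** Positivity makes every [<Q z, z>] real, that is, [rdot (Q z) (i z) = 0]; polarising at
    [z = x + i y] gives the symmetry. *)
Lemma psd_sym Q x y : psd Q -> rdot (Q x) y = rdot (Q y) x.
Proof.
move=> Qpsd.
have Q0 z : rdot (Q z) ('i%C *: z) = 0.
  by rewrite -Im_hdot ger0_Im// Qpsd.
have := Q0 (x + 'i%C *: y); rewrite linearD linearZ/= scalerDr.
rewrite rdotDl !rdotDr rdot_ii Q0 rdot_ii Q0 add0r addr0.
rewrite scalerA -expr2 sqr_i scaleN1r rdotNr addrC => /eqP.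
by rewrite subr_eq0 => /eqP <-.
Qed.

Lemma psd_rdot_ge0 Q x : psd Q -> 0 <= rdot (Q x) x.
Proof. by move=> /(_ x); rewrite lecE => /andP[_]. Qed.

Lemma form_CauchySchwarz Q : (forall x y, rdot (Q x) y = rdot (Q y) x) ->
  (forall x, 0 <= rdot (Q x) x) ->
  forall x y, rdot (Q x) y ^+ 2 <= rdot (Q x) x * rdot (Q y) y.
Proof.
move=> Qs Q0 x y; apply: discriminant_le => t.
have := Q0 (x + t%:C *: y); rewrite linearD linearZ/= rdotDl !rdotDr.
rewrite rdotZl !rdotZr rdotZl (Qs y x); lra.
Qed.

(** Cauchy-Schwarz for the form of [Q] at [x] and [Q x] gives [|Q x|^4 <= C |x|^2 * C |Q x|^2].
    Quadratic form bounds thus become norm bounds. *)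
Lemma form_bounded Q (C : R) : (forall x y, rdot (Q x) y = rdot (Q y) x) ->
  (forall x, 0 <= rdot (Q x) x) -> (forall x, rdot (Q x) x <= C * rnorm x ^+ 2) ->
  0 <= C -> forall x, rnorm (Q x) <= C * rnorm x.
Proof.
move=> Qs Q0 QC Cge0 x.
have [->|] := eqVneq (rnorm (Q x)) 0; first by rewrite mulr_ge0 ?rnorm_ge0.
move=> Qx0; have Qx : 0 < rnorm (Q x) by rewrite lt_def Qx0 rnorm_ge0.
rewrite -ler_sqr ?nnegrE ?mulr_ge0 ?rnorm_ge0//.
rewrite -(@ler_pM2r _ (rnorm (Q x) ^+ 2)) ?exprn_gt0//.
rewrite -expr2 -rdotxx (le_trans (form_CauchySchwarz Qs Q0 _ _))//.
apply: le_trans (ler_pM (Q0 _) (Q0 _) (QC _) (QC _)) _.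
by rewrite rdotxx le_eqVlt; apply/orP; left; apply/eqP; ring.
Qed.

(** With [B] the inverse, Cauchy-Schwarz for the form of [Q] at [B x] and [x] gives [|x|^4 <= <x, B
    x> <Q x, x> <= |B| |x|^2 <Q x, x>]. Adding 1 to [|B|] keeps [d] defined and at most 1. *)
Lemma psd_invertible_lb Q : psd Q -> invertible Q ->
  exists d : R, 0 < d <= 1 /\ forall x, d * rnorm x ^+ 2 <= rdot (Q x) x.
Proof.
move=> Qpsd [B [_ QB]].
have c1 : 1 <= opnorm B + 1 by rewrite lerDr opnorm_ge0.
have c0 : 0 < opnorm B + 1 by exact: lt_le_trans c1.
exists (opnorm B + 1)^-1; split; first by rewrite invr_gt0 c0 invf_le1.
move=> x; rewrite ler_pdivrMl//.
have [->|] := eqVneq (rnorm x) 0.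
  by rewrite expr0n mulr_ge0 ?psd_rdot_ge0// ltW.
move=> xn0; have x0 : 0 < rnorm x by rewrite lt_def xn0 rnorm_ge0.
have QBx : Q (B x) = x by have /(congr1 (fun A : 'B(H) => A x)) := QB.
have Qs y z : rdot (Q y) z = rdot (Q z) y by exact: psd_sym.
have := form_CauchySchwarz Qs (fun z => psd_rdot_ge0 z Qpsd) (B x) x.
rewrite QBx rdotxx => h.
rewrite -(@ler_pM2l _ (rnorm x ^+ 2)) ?exprn_gt0// -expr2.
apply: le_trans h _; rewrite mulrA mulrC [leRHS]mulrC ler_wpM2l ?psd_rdot_ge0//.
rewrite (le_trans (ler_norm _))// (le_trans (rdot_CauchySchwarz _ _))//.
rewrite expr2 -mulrA ler_wpM2l ?rnorm_ge0// (le_trans (opnorm_bound _ _))//.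
by rewrite mulrC ler_wpM2l ?rnorm_ge0// lerDl.
Qed.

(* The fixed point [X = (A + X^2) / 2] satisfies [(1 - X)^2 = 1 - A]; the
   iteration contracts because [|A| <= q < 1]. *)
Lemma root_one_sub A (q : R) : 0 <= q < 1 ->
  (forall x y, rdot (A x) y = rdot (A y) x) ->
  (forall x, rnorm (A x) <= q * rnorm x) ->
  exists L : 'B(H), forall x, rnorm (L x) ^+ 2 = rnorm x ^+ 2 - rdot (A x) x.
Proof.
move=> /andP[q0 q1] As Aq.
pose X := fix X k : 'B(H) :=
  if k is k'.+1 then (1/2)%:C *: (A + X k' * X k') else 0.
have XS k : X k.+1 = (1/2)%:C *: (A + X k * X k) by [].
have opA : opnorm A <= q by exact: opnorm_bounded.
have opZ (Y : 'B(H)) : opnorm ((1/2)%:C *: Y) <= 1/2 * opnorm Y.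
  rewrite (le_trans (opnormZ_le _ _))// ler_wpM2r ?opnorm_ge0//.
  by rewrite -lecR re_normE ger0_norm// ler0c.
have op_ge0 (Y : 'B(H)) := opnorm_ge0 Y.
(* The ball of radius [q] is preserved because [(q + q^2) / 2 <= q]. *)
have Xq k : opnorm (X k) <= q.
  elim: k => [|k IH].
    by rewrite -rnorm_bop rnorm0.
  rewrite XS (le_trans (opZ _))//.
  have := opnormD A (X k * X k); have := opnorm_mul (X k) (X k).
  have : opnorm (X k) * opnorm (X k) <= q * q by rewrite ler_pM.
  nra.
have dX k : opnorm (X k.+1 - X k) <= q * q ^+ k.
  elim: k => [|k IH].
    rewrite subr0 XS mulr0 addr0 expr0 mulr1 (le_trans (opZ _))//; lra.
  (* This splitting of a difference of squares requires no commutation; both outer factors have norm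
     at most [q], so half the sum contracts by [q]. *)
  have -> : X k.+2 - X k.+1 =
      (1/2)%:C *: (X k.+1 * (X k.+1 - X k) + (X k.+1 - X k) * X k).
    rewrite [X k.+2]XS {2}[X k.+1]XS -scalerBr; congr (_ *: _).
    by rewrite mulrBr mulrBl subrKA opprD addrACA subrr add0r.
  rewrite (le_trans (opZ _))// exprS.
  have := opnormD (X k.+1 * (X k.+1 - X k)) ((X k.+1 - X k) * X k).
  have := opnorm_mul (X k.+1) (X k.+1 - X k).
  have := opnorm_mul (X k.+1 - X k) (X k).
  have : opnorm (X k.+1) * opnorm (X k.+1 - X k) <= q * (q * q ^+ k) by rewrite ler_pM.
  have : opnorm (X k.+1 - X k) * opnorm (X k) <= (q * q ^+ k) * q by rewrite ler_pM.
  lra.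
have [Y [XY Yq]] : exists Y : 'B(H), (forall x, X k x @[k --> \oo] --> Y x) /\
    forall x, rnorm (Y x) <= q * rnorm x.
  apply: pointwise_limit_bop => [x|k x]; last first.
    rewrite (le_trans (opnorm_bound _ _))// ler_wpM2r ?rnorm_ge0//.
    exact: Xq.
  apply: (@geometric_rcvg _ _ _ (q * rnorm x) q); first by rewrite q0.
  move=> k; rewrite -bopB (le_trans (opnorm_bound _ _))//.
  by rewrite mulrAC ler_wpM2r ?rnorm_ge0.
have YY x : Y x = (1/2)%:C *: (A x + Y (Y x)).
  (* Both factors vary with [k]; the uniform bound [q] controls the outer one. *)
  have XX : X k (X k x) @[k --> \oo] --> Y (Y x).
    apply: (@rcvg_squeeze _ _ _ _
      (fun k => rnorm (Y (Y x) - X k (Y x)) + q * rnorm (Y x - X k x))).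
      move=> k; rewrite (le_trans (rnorm_distD (X k (Y x)) _ _))// lerD2l.
      rewrite -linearB (le_trans (opnorm_bound _ _))//.
      by rewrite ler_wpM2r ?rnorm_ge0.
    rewrite -[0](addr0) -[X in 0 + X](mulr0 q); apply: cvgD.
      by apply/rcvgP.
    by apply: cvgM; [exact: cvg_cst|apply/rcvgP].
  have XS_cvg : X k.+1 x @[k --> \oo] --> Y x.
    by rewrite (cvg_shiftS (fun k => X k x)).
  apply: (cvg_unique _ XS_cvg) => //.
  apply: cvgZr; apply: cvgD => //; exact: cvg_cst.
have Ysym x y : rdot (Y x) y = rdot (Y y) x.
  have Xs k u v : rdot (X k u) v = rdot (X k v) u.
    elim: k u v => [|k IH] u v.
      by rewrite /= /rdot (linear0l _ v) (linear0l _ u).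
    rewrite XS !bopZ !rdotZl !bopD !rdotDl As; congr (_ * (_ + _)).
    by rewrite !bopM IH rdotC IH.
  have h : rdot (X k x) y @[k --> \oo] --> rdot (Y y) x.
    by under eq_fun do rewrite Xs; exact: rdot_cvg.
  exact: (cvg_unique (@Rhausdorff R) (rdot_cvg (XY x)) h).
(* [Y] is symmetric, so [|x - Y x|^2 = |x|^2 - 2 <Y x, x> + <Y (Y x), x>], and [2 Y = A + Y^2]
   leaves [|x|^2 - <A x, x>]. *)
exists (1 - Y) => x.
have -> : (1 - Y) x = x - Y x by [].
have YYx : rdot (Y x) (Y x) = rdot (Y (Y x)) x by exact: Ysym.
rewrite sqr_rnormB -(rdotxx (Y x)) YYx (rdotC x).
have /(congr1 (fun u => rdot u x)) := YY x.
rewrite rdotZl rdotDl; lra.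
Qed.

(** With [c = |Q| + 1] and [d] the lower bound of [Q], the operator [A = 1 - Q / c] satisfies
    [0 <= A <= 1 - d / c < 1]; a root of [1 - A] is then rescaled by the square root of [c]. *)
Lemma psd_invertible_root Q : psd Q -> invertible Q ->
  exists L : 'B(H), forall x, rnorm (L x) ^+ 2 = rdot (Q x) x.
Proof.
move=> Qpsd Qinv; have [d [/andP[d0 d1] Qd]] := psd_invertible_lb Qpsd Qinv.
have c1 : 1 <= opnorm Q + 1 by rewrite lerDr opnorm_ge0.
have [c cE] : exists c, c = opnorm Q + 1 by eexists.
rewrite -cE in c1; have c0 : 0 < c by exact: lt_le_trans c1.
have Qc x : rdot (Q x) x <= c * rnorm x ^+ 2.
  rewrite (le_trans (ler_norm _))// (le_trans (rdot_CauchySchwarz _ _))//.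
  rewrite expr2 mulrA ler_wpM2r ?rnorm_ge0// (le_trans (opnorm_bound _ _))//.
  by rewrite ler_wpM2r ?rnorm_ge0// cE lerDl.
pose A : 'B(H) := 1 - c^-1%:C *: Q.
have AE x y : rdot (A x) y = rdot x y - c^-1 * rdot (Q x) y.
  have -> : A x = x - c^-1%:C *: Q x by [].
  by rewrite rdotDl rdotNl rdotZl.
have As x y : rdot (A x) y = rdot (A y) x by rewrite !AE rdotC (psd_sym _ _ Qpsd).
have dc : d / c <= 1 by rewrite ler_pdivrMr// mul1r (le_trans d1).
have q0 : 0 <= 1 - d / c by rewrite subr_ge0.
have [||L LE] := @root_one_sub A (1 - d / c) _ As.
- by rewrite q0/= ltrBlDr ltrDl divr_gt0.
- apply: form_bounded => // x; rewrite AE rdotxx.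
    by rewrite subr_ge0 ler_pdivrMl.
  by rewrite mulrBl mul1r lerD2l lerN2 mulrAC mulrC ler_pM2l ?invr_gt0.
exists ((Num.sqrt c)%:C *: L) => x.
rewrite bopZ rnormZ ger0_norm ?sqrtr_ge0// exprMn sqr_sqrtr ?ltW// LE AE rdotxx.
by rewrite opprB addrC subrK mulVKf// gt_eqF.
Qed.

End positive_operators.

(** * Finite orthonormal families *)

Section orthonormal.
Variables (R : realType) (H : hilbertType R).

(** Gram-Schmidt, one vector at a time; a vector already in the span leaves the family unchanged. It
    provides coordinates in the second tensor factor without a basis of [H]. *)
Lemma finite_orthonormal_span (ys : seq H) : exists m (u : 'I_m -> H),
  (forall i j, '[u i, u j] = (i == j)%:R) /\
  {in ys, forall y, y = \sum_i '[y, u i] *: u i}.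
Proof.
elim: ys => [|y ys [m [u [uon uys]]]].
  by exists 0, (fun=> 0); split=> // - [].
pose r := y - \sum_i '[y, u i] *: u i.
have ru j : '[r, u j] = 0.
  rewrite hdotBl hdot_suml (bigD1 j)//= hdotZl uon eqxx mulr1.
  rewrite big1 ?addr0 ?subrr// => i ij.
  by rewrite hdotZl uon (negbTE ij) mulr0.
have [r0|rn0] := eqVneq (rnorm r) 0.
  exists m, u; split=> // z; rewrite inE => /orP[/eqP ->|]; last exact: uys.
  by apply/eqP; rewrite -subr_eq0 -/r; apply/eqP/rnorm_eq0.
pose v := (rnorm r)^-1%:C *: r.
have vu j : '[v, u j] = 0 by rewrite hdotZl ru mulr0.
have vv : '[v, v] = 1.
  by rewrite hdotxx rnormZ ger0_norm ?invr_ge0 ?rnorm_ge0// mulVf ?expr1n.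
pose u' (i : 'I_m.+1) := oapp u v (unlift ord0 i).
have u'0 : u' ord0 = v by rewrite /u' unlift_none.
have u'S i : u' (lift ord0 i) = u i by rewrite /u' liftK.
exists m.+1, u'; split=> [i j|z].
  case: (unliftP ord0 i) => [i' ->|->]; case: (unliftP ord0 j) => [j' ->|->].
  - by rewrite !u'S uon (inj_eq lift_inj).
  - by rewrite u'S u'0 (hdotC v) vu conjC0 eq_sym (negbTE (neq_lift _ _)).
  - by rewrite u'S u'0 vu (negbTE (neq_lift _ _)).
  - by rewrite u'0 vv eqxx.
rewrite big_ord_recl u'0; under eq_bigr do rewrite u'S.
rewrite inE => /orP[/eqP ->|zys].
  have yE : y = r + \sum_i '[y, u i] *: u i by rewrite subrK.
  have rv : r = (rnorm r)%:C *: v.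
    by rewrite scalerA -real_complexM divff// scale1r.
  have -> : '[y, v] = (rnorm r)%:C.
    rewrite {1}yE hdotDl hdot_suml big1 ?addr0; last first.
      by move=> i _; rewrite hdotZl (hdotC v) vu conjC0 mulr0.
    by rewrite {1}rv hdotZl vv mulr1.
  by rewrite -rv -yE.
rewrite {2}(uys _ zys) hdot_suml big1 ?scale0r ?add0r; first exact: uys.
by move=> i _; rewrite hdotZl (hdotC v) vu conjC0 mulr0.
Qed.

End orthonormal.

(** * Tensor products *)

Section closed_span.
Variables (R : realType) (V : normedModType R[i]).

(** The predicate [P] cuts out a closed subspace containing [S]; sequential closedness suffices
    since the topology is given by a norm. *)
Lemma closed_span_ind (S : set V) (P : V -> Prop) x :
  in_closed_span S x -> S `<=` P -> P 0 ->
  (forall k x y, P x -> P y -> P (k *: x + y)) ->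
  (forall (u : nat -> V) l, (forall m, P (u m)) -> u @ \oo --> l -> P l) -> P x.
Proof.
move=> Sx SP P0 PD Pcvg; pose p : {pred V} := fun x => `[< P x >].
have pP y : (y \in p) = `[< P y >] by [].
have psub : GRing.submod_closed p.
  split; first by rewrite pP; apply/asboolP.
  by move=> k y z; rewrite !pP => /asboolP Py /asboolP Pz; apply/asboolP; exact: PD.
have pcl : closed [set` p].
  apply/closed_rcvgP => u l pu ul; rewrite /= pP; apply/asboolP.
  by apply: Pcvg ul => m; apply/asboolP; rewrite -pP; exact: pu.
apply/asboolP; rewrite -pP; apply: (Sx (ClosedSubspace psub pcl)) => y Sy.
by rewrite /= pP; apply/asboolP; exact: SP.
Qed.

Lemma bop_total_ext (W : normedModType R[i]) (S : set V) (A B : 'B(V, W)) :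
  (forall x, in_closed_span S x) -> (forall x, S x -> A x = B x) -> A = B.
Proof.
move=> Stot AB; apply: bop_ext => x.
apply: (@closed_span_ind S (fun x => A x = B x)) => [|||k y z Ay Az|u l Au ul].
- exact: Stot.
- exact: AB.
- by rewrite !linear0.
- by rewrite !bop_linear Ay Az.
- have Al := bop_cvg (A := A) ul; have Bl := bop_cvg (A := B) ul.
  apply: (cvg_unique (@norm_hausdorff _ W) Al).
  by rewrite (_ : (fun m => A (u m)) = fun m => B (u m)) //; apply/funext.
Qed.

End closed_span.

Lemma hdot_total_ext (R : realType) (H : hilbertType R) (S : set H) x y :
  (forall z, in_closed_span S z) -> (forall z, S z -> '[z, x] = '[z, y]) -> x = y.
Proof.
move=> Stot xy; apply/eqP; rewrite -subr_eq0; apply/eqP; set w := x - y.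
suff w0 z : '[z, w] = 0 by apply: hdot_extr => z; rewrite w0 linear0r.
apply: (@closed_span_ind _ _ S (fun z => '[z, w] = 0)) => [|u Su||k u v uw vw|u l uw ul].
- exact: Stot.
- by rewrite linearBr/= xy// subrr.
- by rewrite linear0l.
- by rewrite hdotDl hdotZl uw vw mulr0 addr0.
have rdot0 v : (forall m, rdot (u m) v = 0) -> rdot l v = 0.
  move=> uv; have ulv : rdot (u m) v @[m --> \oo] --> rdot l v by exact: rdot_cvg.
  apply: (cvg_unique (@Rhausdorff R) ulv).
  by rewrite (_ : (fun m => _) = cst 0); [exact: cvg_cst|exact/funext].
rewrite hdot_rdot !rdot0// => m; last by rewrite /rdot uw.
by rewrite -Im_hdot uw.
Qed.

Section hilbert_tensor.
Variables (R : realType) (F H FH : hilbertType R).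
Variables (t : {bilinear F -> H -> FH}) (tP : hilbert_tensor t).

Lemma tens_dot x x' y y' : '[t x y, t x' y'] = '[x, x'] * '[y, y'].
Proof. by case: tP => + _; apply. Qed.

Lemma tensDl x x' y : t (x + x') y = t x y + t x' y.
Proof. exact: linearDl. Qed.

Lemma tensNl x y : t (- x) y = - t x y.
Proof. exact: linearNl. Qed.

Lemma tensDr x y y' : t x (y + y') = t x y + t x y'.
Proof. exact: linearDr. Qed.

Lemma tensZl k x y : t (k *: x) y = k *: t x y.
Proof. by rewrite linearZl_LR. Qed.

Lemma tensZr k x y : t x (k *: y) = k *: t x y.
Proof. by rewrite linearZr_LR. Qed.

Lemma tens_suml I (r : seq I) (f : I -> F) y :
  t (\sum_(i <- r) f i) y = \sum_(i <- r) t (f i) y.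
Proof. exact: linear_sumlz. Qed.

Lemma tens_sumr I (r : seq I) x (f : I -> H) :
  t x (\sum_(i <- r) f i) = \sum_(i <- r) t x (f i).
Proof. exact: linear_sumr. Qed.

Lemma rnorm_tens x y : rnorm (t x y) = rnorm x * rnorm y.
Proof.
apply: (@pexpIrn _ 2) => //; rewrite ?nnegrE ?mulr_ge0 ?rnorm_ge0//.
apply: complexI.
by rewrite -hdotxx tens_dot !hdotxx exprMn -real_complexM.
Qed.

Lemma tensl_exists x : exists A : 'B(H, FH), A =1 t x.
Proof.
apply: (@bounded_linear_bop _ _ _ _ (rnorm x)) => [k y y'|y].
  by rewrite tensDr tensZr.
by rewrite rnorm_tens.
Qed.

Definition tensl x : 'B(H, FH) := sval (cid (tensl_exists x)).

Lemma tenslE x y : tensl x y = t x y.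
Proof. by rewrite /tensl; case: cid. Qed.

Lemma tensr_cvg (u : nat -> F) l y :
  u @ \oo --> l -> t (u m) y @[m --> \oo] --> t l y.
Proof.
move=> /rcvgP ul; apply: (@rcvg_squeeze _ _ _ _ (fun m => rnorm (l - u m) * rnorm y)).
  by move=> m; rewrite -rnorm_tens tensDl tensNl.
by rewrite -[X in _ --> X](mul0r (rnorm y)); apply: cvgM => //; exact: cvg_cst.
Qed.

(* Expanding the second factors in an orthonormal family [u] turns
   [sum_w t (x w) (y j w)] into [sum_l t (f j l) (u l)], whose norm is the l^2
   norm of the [f j l]. *)
Lemma tens_mx_estimate (I : eqType) (s : seq I) k (A : 'M['B(F)]_k) (c : R)
    (x : I -> F) (y : 'I_k -> I -> H) :
  (forall z : 'I_k -> F, \sum_i rnorm (\sum_j A i j (z j)) ^+ 2 <=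
     c * \sum_j rnorm (z j) ^+ 2) ->
  \sum_i rnorm (\sum_j \sum_(w <- s) t (A i j (x w)) (y j w)) ^+ 2 <=
  c * \sum_j rnorm (\sum_(w <- s) t (x w) (y j w)) ^+ 2.
Proof.
move=> Ac.
(* One family for all columns [j] at once: the matrix [A] then acts separately on each coordinate
   [l]. *)
have [m [u [uon yu]]] := finite_orthonormal_span
  [seq y j w | j <- enum 'I_k, w <- s].
have tu (g : 'I_m -> F) : rnorm (\sum_l t (g l) (u l)) ^+ 2 = \sum_l rnorm (g l) ^+ 2.
  apply: complexI; rewrite -hdotxx hdot_suml rmorph_sum/=; apply: eq_bigr => l _.
  rewrite hdot_sumr (bigD1 l)//= big1 ?addr0 => [|l' l'l].
    by rewrite tens_dot uon eqxx mulr1 hdotxx.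
  by rewrite tens_dot uon eq_sym (negbTE l'l) mulr0.
pose f j l := \sum_(w <- s) '[y j w, u l] *: x w.
have expand (B : 'B(F)) j :
    \sum_(w <- s) t (B (x w)) (y j w) = \sum_l t (B (f j l)) (u l).
  transitivity (\sum_(w <- s) \sum_l '[y j w, u l] *: t (B (x w)) (u l)).
    apply: eq_big_seq => w ws.
    rewrite {1}(yu (y j w)); last by apply: allpairs_f => //; rewrite mem_enum.
    by rewrite tens_sumr; apply: eq_bigr => l _; rewrite tensZr.
  rewrite exchange_big; apply: eq_bigr => l _ /=.
  rewrite /f linear_sum tens_suml; apply: eq_bigr => w _.
  by rewrite linearZ/= tensZl.
have -> : \sum_i rnorm (\sum_j \sum_(w <- s) t (A i j (x w)) (y j w)) ^+ 2 =
    \sum_l \sum_i rnorm (\sum_j A i j (f j l)) ^+ 2.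
  rewrite exchange_big; apply: eq_bigr => i _ /=.
  rewrite -tu; congr (rnorm _ ^+ 2); under eq_bigr do rewrite expand.
  by rewrite exchange_big; apply: eq_bigr => l _ /=; rewrite tens_suml.
have -> : \sum_j rnorm (\sum_(w <- s) t (x w) (y j w)) ^+ 2 =
    \sum_l \sum_j rnorm (f j l) ^+ 2.
  rewrite exchange_big; apply: eq_bigr => j _ /=.
  by rewrite -tu -(expand 1).
by rewrite mulr_sumr; apply: ler_sum => l _; exact: Ac.
Qed.

Lemma tens_estimate (I : eqType) (s : seq I) (A : 'B(F)) (x : I -> F) (y : I -> H) :
  rnorm (\sum_(w <- s) t (A (x w)) (y w)) <=
  opnorm A * rnorm (\sum_(w <- s) t (x w) (y w)).
Proof.
have := @tens_mx_estimate _ s 1 (const_mx A) (opnorm A ^+ 2) x (fun=> y).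
rewrite !big_ord1 !mxE -exprMn ler_sqr ?nnegrE ?mulr_ge0 ?opnorm_ge0 ?rnorm_ge0//.
apply=> z; rewrite !big_ord1 !mxE -exprMn.
by rewrite ler_sqr ?nnegrE ?mulr_ge0 ?opnorm_ge0 ?rnorm_ge0// opnorm_bound.
Qed.

End hilbert_tensor.

(** * Amplifications of operators on the first tensor factor *)

Section amplification.
Variables (R : realType) (I : eqType) (F H FH : hilbertType R).
Variables (t : {bilinear F -> H -> FH}) (tP : hilbert_tensor t).
Variables (e : I -> F) (eP : orthonormal_basis e).

Lemma onb_dot i j : '[e i, e j] = (i == j)%:R.
Proof. by case: eP => + _; apply. Qed.

Lemma onb_total x : in_closed_span (range e) x.
Proof. by case: eP. Qed.

Lemma tens_basis_total z : in_closed_span [set t (e i) y | i in setT & y in setT] z.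
Proof.
move=> M SM; case: tP => _ /(_ z); apply => _ [x _ [y _ <-]] /=.
apply: (@closed_span_ind _ _ _ (fun x => t x y \in cs_pred M) x (onb_total x))
    => [_ [i _ <-]||k u v uM vM|u l uM ul].
- by apply: SM; exists i => //; exists y.
- by rewrite linear0l; case: (cs_submod M).
- by rewrite (tensDl t) (tensZl t); case: (cs_submod M) => _; apply.
- by have /closed_rcvgP := @cs_closed _ _ M; apply; [exact: uM|exact: tensr_cvg].
Qed.

(** The coordinate of index [i] when the tensor product is seen as the Hilbert sum of the copies of
    [H] given by [e i (x) H]. *)
Definition slice i : 'B(FH, H) := adj (tensl tP (e i)).

Lemma slice_basis i j y : slice i (t (e j) y) = (i == j)%:R *: y.
Proof.
apply: hdot_extr => z; rewrite -adjP tenslE tens_dot// onb_dot.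
by rewrite hdotZr conjC_nat.
Qed.

Lemma rnorm_basis_sum (s : seq I) (f : I -> H) : uniq s ->
  rnorm (\sum_(i <- s) t (e i) (f i)) ^+ 2 = \sum_(i <- s) rnorm (f i) ^+ 2.
Proof.
move=> us; apply: complexI; rewrite -hdotxx hdot_suml rmorph_sum/=.
apply: eq_big_seq => i si; rewrite hdot_sumr (bigD1_seq i)//= big1 ?addr0.
  by rewrite tens_dot// onb_dot eqxx mul1r hdotxx.
by move=> j ji; rewrite tens_dot// onb_dot eq_sym (negbTE ji) mul0r.
Qed.

Lemma sum_slice_basis (s : seq I) (g : I -> F) j y : uniq s -> j \in s ->
  \sum_(i <- s) t (g i) (slice i (t (e j) y)) = t (g j) y.
Proof.
move=> us js; rewrite (bigD1_seq j)//= slice_basis eqxx scale1r big1 ?addr0// => i ij.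
by rewrite slice_basis (negbTE ij) scale0r linear0r.
Qed.

(** For [s] without repetition, the orthogonal projection onto the sum of the [e i (x) H], [i] in
    [s]. *)
Definition partial_expansion (s : seq I) : 'B(FH) :=
  \sum_(i <- s) bop_comp (tensl tP (e i)) (slice i).

Lemma partial_expansionE s z :
  partial_expansion s z = \sum_(i <- s) t (e i) (slice i z).
Proof.
by rewrite /partial_expansion bop_sum; apply: eq_bigr => i _ /=; rewrite tenslE.
Qed.

(** Bessel's inequality, from [|P z|^2 = Re <P z, z>]. *)
Lemma partial_expansion_contr s z : uniq s ->
  rnorm (partial_expansion s z) <= rnorm z.
Proof.
move=> us.
have h : rnorm (partial_expansion s z) ^+ 2 = rdot (partial_expansion s z) z.
  rewrite partial_expansionE rnorm_basis_sum// /rdot hdot_suml Re_sum.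
  by apply: eq_bigr => i _; rewrite -tenslE adjP hdotxx.
have [->|] := eqVneq (rnorm (partial_expansion s z)) 0; first exact: rnorm_ge0.
move=> n0; have n_gt0 : 0 < rnorm (partial_expansion s z).
  by rewrite lt_def n0 rnorm_ge0.
rewrite -(ler_pM2l n_gt0) -expr2 h (le_trans (ler_norm _))//.
exact: rdot_CauchySchwarz.
Qed.

(** * Exhaustion of the index set by increasing finite lists *)

Section exhaustion.
Variables (r : nat -> seq I) (r_uniq : forall m, uniq (r m)).
Hypothesis r_mono : forall m, exists s, r m.+1 = r m ++ s.
Hypothesis r_exh : forall i, exists m, i \in r m.

Lemma exhaustion_prefix N m : (N <= m)%N -> exists s, r m = r N ++ s.
Proof.
move=> /subnKC <-; elim: (m - N)%N => [|p [s IH]]; first by exists [::]; rewrite addn0 cats0.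
by rewrite addnS; have [s' ->] := r_mono (N + p); exists (s ++ s'); rewrite IH catA.
Qed.

Lemma exhaustion_near j : \forall m \near \oo, j \in r m.
Proof.
have [N jN] := r_exh j; exists N => // m /= /exhaustion_prefix[s ->].
by rewrite mem_cat jN.
Qed.

(** On a basis tensor [e j (x) y] the expansions are eventually stationary; being contractions, they
    converge on the closed span as well. *)
Lemma partial_expansion_cvg z : partial_expansion (r m) z @[m --> \oo] --> z.
Proof.
apply: (@closed_span_ind _ _ _ (fun z => partial_expansion (r m) z @[m --> \oo] --> z)
   z (tens_basis_total z)) => [_ [j _ [y _ <-]]||k u v Pu Pv|u l Pu ul].
- apply: cvg_near_cst; apply: filterS (exhaustion_near j) => m jm.
  by rewrite partial_expansionE sum_slice_basis.
- by under eq_fun do rewrite linear0; exact: cvg_cst.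
- rewrite (_ : (fun m => _) = fun m =>
    k *: partial_expansion (r m) u + partial_expansion (r m) v); last first.
    by apply/funext => m; rewrite bop_linear.
  by apply: cvgD => //; exact: cvgZr.
apply/rcvgP/cvgrPdist_lt => d d0.
have d3 : 0 < d / 3 by rewrite divr_gt0.
have /rcvgP/cvgrPdist_lt/(_ _ d3)[N _ /(_ N (leqnn N))] := ul.
have /rcvgP/cvgrPdist_lt/(_ _ d3) := Pu N.
rewrite /= !sub0r normrN ger0_norm ?rnorm_ge0// => uN lN.
apply: filterS uN => m; rewrite !sub0r !normrN !ger0_norm ?rnorm_ge0// => uN.
rewrite (le_lt_trans (rnorm_distD (u N) _ _))//.
have := rnorm_distD (partial_expansion (r m) (u N)) (u N) (partial_expansion (r m) l).
rewrite -linearB; have := partial_expansion_contr (u N - l) (r_uniq m).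
rewrite (rnormBC (u N) l); lra.
Qed.

(** [A (x) I] is the strong limit of its truncations: by [tens_estimate], their differences are
    bounded by [|A|] times those of the expansions of [z], which converge. *)
Lemma amplification_exists (A : 'B(F)) :
  exists C : 'B(FH), forall x y, C (t x y) = t (A x) y.
Proof.
pose C_ m : 'B(FH) := \sum_(i <- r m) bop_comp (tensl tP (A (e i))) (slice i).
have C_E m z : C_ m z = \sum_(i <- r m) t (A (e i)) (slice i z).
  by rewrite /C_ bop_sum; apply: eq_bigr => i _ /=; rewrite tenslE.
have [C [CC _]] : exists C : 'B(FH), (forall x, C_ m x @[m --> \oo] --> C x) /\
    forall x, rnorm (C x) <= opnorm A * rnorm x.
  apply: pointwise_limit_bop => [z|m z]; last first.
    rewrite C_E (le_trans (tens_estimate tP _ _ _ _))// ler_wpM2l ?opnorm_ge0//.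
    by rewrite -partial_expansionE partial_expansion_contr.
  apply: rcauchy_cvg => d d0.
  (* Adding 1 permits the division when [A = 0]. *)
  have c0 : 0 < opnorm A + 1 by rewrite ltr_wpDl ?opnorm_ge0.
  have dc : 0 < d / (opnorm A + 1) / 2 by rewrite !divr_gt0.
  have /rcvgP/cvgrPdist_lt/(_ _ dc)[N _ Ne] := @partial_expansion_cvg z.
  exists N => m Nm; have [s rE] := exhaustion_prefix Nm.
  have := Ne _ Nm; have := Ne _ (leqnn N).
  rewrite /= !sub0r !normrN !ger0_norm ?rnorm_ge0// => zN zm.
  rewrite !C_E rE big_cat/= addrAC subrr add0r (le_lt_trans (tens_estimate tP _ _ _ _))//.
  have -> : \sum_(w <- s) t (e w) (slice w z) =
      partial_expansion (r m) z - partial_expansion (r N) z.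
    by rewrite !partial_expansionE rE big_cat/= addrAC subrr add0r.
  apply: le_lt_trans (_ : (opnorm A + 1) * rnorm (partial_expansion (r m) z -
    partial_expansion (r N) z) < _).
    by rewrite ler_wpM2r ?rnorm_ge0// lerDl.
  rewrite -ltr_pdivlMl// mulrC.
  rewrite (le_lt_trans (rnorm_distD z _ _))// (rnormBC _ z); lra.
have Ce j y : C (t (e j) y) = t (A (e j)) y.
  apply: (cvg_unique (@norm_hausdorff _ FH) (CC _)).
  apply: cvg_near_cst; apply: filterS (exhaustion_near j) => m jm.
  by rewrite C_E (sum_slice_basis (A \o e)).
exists C => x y.
apply: (@closed_span_ind _ _ _ (fun x => C (t x y) = t (A x) y) x (onb_total x))
    => [_ [i _ <-]||k u v Cu Cv|u l Cu ul].
- exact: Ce.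
- by rewrite linear0l !linear0 linear0l.
- by rewrite (tensDl t) (tensZl t) !bop_linear Cu Cv (tensDl t) (tensZl t).
have h1 : C (t (u m) y) @[m --> \oo] --> C (t l y) by apply: bop_cvg; exact: tensr_cvg.
have h2 : t (A (u m)) y @[m --> \oo] --> t (A l) y by apply: tensr_cvg => //; exact: bop_cvg.
apply: (cvg_unique (@norm_hausdorff _ FH) h1).
by rewrite (_ : (fun m => _) = fun m => t (A (u m)) y)//; apply/funext.
Qed.

Lemma tensor_opP (A : 'B(F)) x y :
  tensor_op t A (bop_id H) (t x y) = t (A x) y.
Proof.
move: x y.
apply: (@xgetPex _ 0 [set C : 'B(FH) | forall x y, C (t x y) = t (A x) (bop_id H y)]).
exact: amplification_exists.
Qed.

Notation amp A := (tensor_op t A (bop_id H)).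

Lemma amp_ext (C D : 'B(FH)) :
  (forall i y, C (t (e i) y) = D (t (e i) y)) -> C = D.
Proof.
by move=> CD; apply: (bop_total_ext tens_basis_total) => _ [i _ [y _ <-]].
Qed.

Lemma amp_linear k A B : amp (k *: A + B) = k *: amp A + amp B.
Proof.
by apply: amp_ext => i y; rewrite bopD bopZ !tensor_opP bopD bopZ (tensDl t) (tensZl t).
Qed.

Lemma ampM A B : amp (A * B) = amp A * amp B.
Proof. by apply: amp_ext => i y; rewrite bopM !tensor_opP. Qed.

Lemma amp1 : amp 1 = 1.
Proof. by apply: amp_ext => i y; rewrite tensor_opP. Qed.

Lemma adj_amp A : adj (amp A) = amp (adj A).
Proof.
apply: amp_ext => i y; apply: (hdot_total_ext (proj2 tP)) => _ [x _ [y' _ <-]].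
by rewrite -adjP !tensor_opP !tens_dot// adjP.
Qed.

(** The estimate for finite sums passes to the limit of the expansions with the same [c]:
    amplification is completely contractive. The complete bound of the functional calculus rests on
    this. *)
Lemma amp_mx_estimate k (A : 'M['B(F)]_k) (c : R) (z : 'I_k -> FH) :
  (forall x : 'I_k -> F, \sum_i rnorm (\sum_j A i j (x j)) ^+ 2 <=
     c * \sum_j rnorm (x j) ^+ 2) ->
  \sum_i rnorm (\sum_j amp (A i j) (z j)) ^+ 2 <= c * \sum_j rnorm (z j) ^+ 2.
Proof.
move=> Ac.
have Pz j := @partial_expansion_cvg (z j).
have lhs : \sum_i rnorm (\sum_j amp (A i j) (partial_expansion (r m) (z j))) ^+ 2
    @[m --> \oo] --> \sum_i rnorm (\sum_j amp (A i j) (z j)) ^+ 2.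
  apply: cvg_big => [|i _]; first exact: add_continuous.
  apply: rcvg_sqr_rnorm; apply: cvg_big => [|j _]; first exact: add_continuous.
  exact: bop_cvg.
have rhs : c * \sum_j rnorm (partial_expansion (r m) (z j)) ^+ 2
    @[m --> \oo] --> c * \sum_j rnorm (z j) ^+ 2.
  apply: cvgM; first exact: cvg_cst.
  apply: cvg_big => [|j _]; first exact: add_continuous.
  exact: rcvg_sqr_rnorm.
apply: (ler_cvg_to lhs rhs); apply: nearW => m.
have := @tens_mx_estimate _ _ _ _ _ tP _ (r m) _ A c e (fun j i => slice i (z j)) Ac.
under [X in _ <= c * X]eq_bigr do rewrite -partial_expansionE.
congr (_ <= _); apply: eq_bigr => i _; congr (rnorm _ ^+ 2).
apply: eq_bigr => j _; rewrite partial_expansionE bop_sumr.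
by apply: eq_bigr => w _; rewrite tensor_opP.
Qed.

Lemma opnorm_amp_le A : opnorm (amp A) <= opnorm A.
Proof.
apply: opnorm_bounded => [|z]; first exact: opnorm_ge0.
rewrite -ler_sqr ?nnegrE ?mulr_ge0 ?opnorm_ge0 ?rnorm_ge0// exprMn.
have := @amp_mx_estimate 1 (const_mx A) (opnorm A ^+ 2) (fun=> z).
rewrite !big_ord1 !mxE; apply=> x; rewrite !big_ord1 !mxE -exprMn.
by rewrite ler_sqr ?nnegrE ?mulr_ge0 ?opnorm_ge0 ?rnorm_ge0// opnorm_bound.
Qed.

Lemma amp0 : amp 0 = 0.
Proof. by apply: amp_ext => i y; rewrite tensor_opP linear0l. Qed.

Lemma ampD A B : amp (A + B) = amp A + amp B.
Proof. by rewrite -[A]scale1r amp_linear !scale1r. Qed.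

Lemma ampZ k A : amp (k *: A) = k *: amp A.
Proof. by rewrite -[k *: A]addr0 amp_linear amp0 addr0. Qed.

Lemma amp_sum J (s : seq J) (A : J -> 'B(F)) :
  amp (\sum_(i <- s) A i) = \sum_(i <- s) amp (A i).
Proof.
elim: s => [|i s IH]; first by rewrite !big_nil amp0.
by rewrite !big_cons ampD IH.
Qed.

End exhaustion.
End amplification.

(** * The Poisson kernel *)

Section words.
Variable n : nat.

Definition level k : seq (seq 'I_n) := [seq val w | w <- enum {: k.-tuple 'I_n}].

Lemma mem_level k w : (w \in level k) = (size w == k).
Proof.
apply/mapP/eqP => [[v _ ->]|wk]; first exact: size_tuple.
have wk' : size w == k by rewrite wk.
by exists (Tuple wk'); rewrite ?mem_enum.
Qed.

Lemma uniq_level k : uniq (level k).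
Proof. by rewrite (map_inj_uniq val_inj) enum_uniq. Qed.

Lemma big_level (V : nmodType) k (G : seq 'I_n -> V) :
  \sum_(w <- level k) G w = \sum_(w : k.-tuple 'I_n) G w.
Proof. by rewrite big_map /= big_enum. Qed.

Lemma big_tuple_cat (V : nmodType) k l (G : seq 'I_n -> V) :
  \sum_(w : (k + l).-tuple 'I_n) G w =
  \sum_(u : k.-tuple 'I_n) \sum_(v : l.-tuple 'I_n) G (u ++ v).
Proof.
transitivity (\sum_(w <- [seq u ++ v | u <- level k, v <- level l]) G w); last first.
  rewrite big_allpairs_dep [LHS]big_level; apply: eq_bigr => u _.
  exact: (big_level l (fun v => G (u ++ v))).
rewrite -big_level; apply: perm_big.
apply: uniq_perm; first exact: uniq_level.
  apply: allpairs_uniq; rewrite ?uniq_level// => -[u v] [u' v'].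
  move=> /allpairsP[[p q] /= [+ _ [-> ->]]] /allpairsP[[p' q'] /= [+ _ [-> ->]]].
  rewrite !mem_level => /eqP pk /eqP p'k /eqP.
  by rewrite eqseq_cat ?pk ?p'k// => /andP[/eqP -> /eqP ->].
move=> w; rewrite mem_level; apply/eqP/allpairsP => [wkl|[[u v] [/=]]].
  exists (take k w, drop k w); rewrite /= !mem_level cat_take_drop size_drop.
  by rewrite size_takel wkl ?leq_addr// addKn.
by rewrite !mem_level => /eqP <- /eqP <- ->; rewrite size_cat.
Qed.

(** Lengths strictly below [m], so that sums over [words m] are exactly the partial sums over
    [k < m] of the given operator series. *)
Fixpoint words m : seq (seq 'I_n) :=
  if m is m'.+1 then words m' ++ level m' else [::].

Lemma mem_words m w : (w \in words m) = (size w < m)%N.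
Proof.
by elim: m => [|m IH] //=; rewrite mem_cat IH mem_level [RHS]ltnS [RHS]leq_eqVlt orbC.
Qed.

Lemma uniq_words m : uniq (words m).
Proof.
elim: m => [|m IH] //=; rewrite cat_uniq IH uniq_level andbT/=.
by apply/hasPn => w; rewrite mem_level mem_words => /eqP ->; rewrite ltnn.
Qed.

Lemma big_words (V : nmodType) m (G : seq 'I_n -> V) :
  \sum_(w <- words m) G w = \sum_(k < m) \sum_(w : k.-tuple 'I_n) G w.
Proof.
elim: m => [|m IH]; first by rewrite big_nil big_ord0.
by rewrite big_ord_recr /= big_cat IH big_level.
Qed.

Lemma wordsS m : exists s, words m.+1 = words m ++ s.
Proof. by eexists. Qed.

Lemma words_exhaust w : exists m, w \in words m.
Proof. by exists (size w).+1; rewrite mem_words. Qed.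

End words.

Lemma weight_prod_cons (R : realType) n (mu : seq 'I_n -> R) i w :
  weight_prod mu (i :: w) = mu (i :: w) * weight_prod mu w.
Proof. by rewrite /weight_prod big_ord_recl. Qed.

Section poisson_kernel.
Variables (R : realType) (n : nat) (mu : seq 'I_n -> R).
Variables (F H FH : hilbertType R) (e : seq 'I_n -> F) (eP : orthonormal_basis e).
Variables (t : {bilinear F -> H -> FH}) (tP : hilbert_tensor t).
Variables (T : 'I_n -> 'B(H)) (Q L : 'B(H)).
Hypothesis LQ : forall x, rnorm (L x) ^+ 2 = rdot (Q x) x.
Variables (S : 'B(H)).
Hypothesis S_series : wot_series (fun k => \sum_(w : k.-tuple 'I_n)
  ((weight_prod mu w) ^- 2)%:C *: (word_op T w * Q * adj (word_op T w))) S.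

Let c w := (weight_prod mu w)^-1.

Let coef h w := (c w)%:C *: L (adj (word_op T w) h).

(** The weak operator series enters only through its diagonal at [h], where [Q = L^* L] turns each
    term into the square of a norm. *)
Lemma sq_coef_cvg h :
  \sum_(w <- words n m) rnorm (coef h w) ^+ 2 @[m --> \oo] --> rdot (S h) h.
Proof.
have /cvgrPdist_lt Sh := @S_series h h; apply/cvgrPdist_lt => d d0.
have /Sh : 0 < d%:C by rewrite ltcR.
apply: filterS => m; rewrite -ltcR; apply: le_lt_trans.
have -> : \sum_(w <- words n m) rnorm (coef h w) ^+ 2 = complex.Re
    '[(\sum_(k < m) \sum_(w : k.-tuple 'I_n)
  ((weight_prod mu w) ^- 2)%:C *: (word_op T w * Q * adj (word_op T w))) h, h].
  rewrite big_words bop_sum hdot_suml Re_sum.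
  apply: eq_bigr => k _; rewrite bop_sum hdot_suml Re_sum.
  apply: eq_bigr => w _; rewrite bopZ !bopM -/(rdot _ _) rdotZl rdot_adj.
  rewrite -LQ rnormZ exprMn real_normK ?num_real// /c exprVn.
  by [].
by rewrite /rdot -ReN -ReD; exact: normc_ge_Re.
Qed.

(** For [N <= m], orthogonality makes [|K_m h - K_N h|^2] a difference of partial sums of a
    convergent series of nonnegative terms, so the truncations converge strongly. The slice of [K h]
    at [w] is [coef h w], and its adjoint gives [adj K] on basis tensors. *)
Lemma poisson_kernel_exists : exists K : 'B(H, FH),
  (forall h, rnorm (K h) ^+ 2 = rdot (S h) h) /\
  forall w y, adj K (t (e w) y) = (c w)%:C *: word_op T w (adj L y).
Proof.
pose s m h := \sum_(w <- words n m) rnorm (coef h w) ^+ 2.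
pose K_ m : 'B(H, FH) := \sum_(w <- words n m) (c w)%:C *:
  bop_comp (tensl tP (e w)) (bop_comp L (adj (word_op T w))).
have K_E m h : K_ m h = \sum_(w <- words n m) t (e w) (coef h w).
  by rewrite /K_ bop_sum; apply: eq_bigr => w _; rewrite bopZ/= tenslE /coef (tensZr t).
have K_s m h : rnorm (K_ m h) ^+ 2 = s m h.
  by rewrite K_E (rnorm_basis_sum tP eP)// uniq_words.
have s_diff N m h : (N <= m)%N -> rnorm (K_ m h - K_ N h) ^+ 2 = s m h - s N h.
  move=> /(exhaustion_prefix (@wordsS n))[r mE].
  rewrite !K_E /s mE !big_cat/= [X in rnorm X]addrAC subrr add0r.
  rewrite [RHS]addrAC subrr add0r (rnorm_basis_sum tP eP)//.
  by have := uniq_words n m; rewrite mE cat_uniq => /and3P[].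
have s_mono N m h : (N <= m)%N -> s N h <= s m h.
  by move=> Nm; rewrite -subr_ge0 -s_diff// sqr_ge0.
have s_le m h : s m h <= rdot (S h) h.
  apply: (cvgr_to_ge (@sq_coef_cvg h)); exists m => // p /= mp; exact: s_mono.
have [K [KK _]] : exists K : 'B(H, FH), (forall h, K_ m h @[m --> \oo] --> K h) /\
    forall h, rnorm (K h) <= Num.sqrt (opnorm S) * rnorm h.
  apply: pointwise_limit_bop => [h|m h]; last first.
    rewrite -ler_sqr ?nnegrE ?mulr_ge0 ?rnorm_ge0 ?sqrtr_ge0//.
    rewrite exprMn sqr_sqrtr ?opnorm_ge0// K_s (le_trans (s_le _ _))//.
    rewrite (le_trans (ler_norm _))// (le_trans (rdot_CauchySchwarz _ _))//.
    by rewrite expr2 mulrA ler_wpM2r ?rnorm_ge0// opnorm_bound.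
  apply: rcauchy_cvg => d d0.
  have d2 : 0 < d ^+ 2 by rewrite exprn_gt0.
  have /cvgrPdist_lt/(_ _ d2)[N _ /(_ N (leqnn N)) Ne] := @sq_coef_cvg h.
  exists N => m Nm; rewrite -ltr_sqr ?nnegrE ?rnorm_ge0 ?ltW// s_diff//.
  apply: le_lt_trans Ne; rewrite (le_trans _ (ler_norm _))// lerD2r; exact: s_le.
exists K; split=> [h|w y].
  have Ks := rcvg_sqr_rnorm (KK h).
  apply: (cvg_unique (@Rhausdorff R) Ks).
  rewrite (_ : (fun m => rnorm (K_ m h) ^+ 2) = s ^~ h); first exact: sq_coef_cvg.
  by apply/funext => m; rewrite K_s.
have sliceK h : slice tP e w (K h) = coef h w.
  apply: (cvg_unique (@norm_hausdorff _ H) (bop_cvg (A := slice tP e w) (KK h))).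
  apply: cvg_near_cst; exists (size w).+1 => // m /= wm.
  rewrite K_E bop_sumr (bigD1_seq w)/= ?uniq_words ?mem_words//.
  rewrite (slice_basis tP eP) eqxx scale1r big1 ?addr0// => v vw.
  by rewrite (slice_basis tP eP) eq_sym (negbTE vw) scale0r.
apply: hdot_extr => h; rewrite -adjP -(tenslE tP) adjPr -/(slice tP e w) sliceK.
rewrite hdotZl hdotZr adjP adjP adjK; congr (_ * _).
exact: (esym (conjc_real _)).
Qed.

End poisson_kernel.

(** * Dilation and similarity *)

Section closed_range.
Variables (R : realType) (H G : hilbertType R) (K : 'B(H, G)) (a : R).
Hypotheses (a_gt0 : 0 < a) (Ka : forall h, a * rnorm h ^+ 2 <= rnorm (K h) ^+ 2).

Lemma bounded_below h : rnorm h <= (Num.sqrt a)^-1 * rnorm (K h).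
Proof.
have sa : 0 < Num.sqrt a by rewrite sqrtr_gt0.
rewrite ler_pdivlMl// -ler_sqr ?nnegrE ?mulr_ge0 ?rnorm_ge0 ?sqrtr_ge0//.
by rewrite exprMn sqr_sqrtr ?Ka// ltW.
Qed.

Definition range_pred : {pred G} := fun z => `[< exists h, K h = z >].

Lemma range_submod : GRing.submod_closed range_pred.
Proof.
split; first by apply/asboolP; exists 0; rewrite linear0.
move=> k _ _ /asboolP[h <-] /asboolP[h' <-]; apply/asboolP.
by exists (k *: h + h'); rewrite linearP.
Qed.

(** The lower bound makes the preimages of a convergent sequence in the range Cauchy. *)
Lemma range_closed : closed [set` range_pred].
Proof.
apply/closed_rcvgP => z l zK zl.
have /choice[h hz] : forall m, exists h, K h = z m by move=> m; exact/asboolP/zK.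
have [h0 hh0] : exists h0 : H, h @ \oo --> h0.
  apply: rcauchy_cvg => d d0.
  have d2 : 0 < Num.sqrt a * d / 2 by rewrite !(divr_gt0, mulr_gt0)// sqrtr_gt0.
  have /rcvgP/cvgrPdist_lt/(_ _ d2)[N _ Ne] := zl.
  exists N => m Nm; rewrite (le_lt_trans (bounded_below _))// bop_subr !hz.
  rewrite ltr_pdivrMl ?sqrtr_gt0// (le_lt_trans (rnorm_distD l _ _))//.
  have := Ne _ Nm; have := Ne _ (leqnn N).
  rewrite /= !sub0r !normrN !ger0_norm ?rnorm_ge0// (rnormBC (z m)); lra.
apply/asboolP; exists h0; apply: (cvg_unique (@norm_hausdorff _ G) (bop_cvg (A := K) hh0)).
by rewrite (_ : (fun m => _) = z)//; exact/funext.
Qed.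

Definition range_space : closed_subspace G :=
  ClosedSubspace range_submod range_closed.

Let M := range_space.

Lemma range_spaceP z : z \in cs_pred M -> exists h, K h = z.
Proof. by move/asboolP. Qed.

Lemma range_space_mem h : K h \in cs_pred M.
Proof. by apply/asboolP; exists h. Qed.

Lemma range_iso : exists (k : 'B(H, subsp M)) (l : 'B(subsp M, H)),
  [/\ forall h, subsp_val (k h) = K h, cancel k l, cancel l k &
      forall z, rnorm (l z) <= (Num.sqrt a)^-1 * rnorm z].
Proof.
pose kf h : subsp M := Subsp (range_space_mem h).
have klin : linear kf by move=> c x y; apply/val_inj => /=; rewrite linearP.
have [k kE] : exists k : 'B(H, subsp M), k =1 kf.
  exact: (bounded_linear_bop klin (fun x => opnorm_bound K x)).
have kK h : subsp_val (k h) = K h by rewrite kE.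
have /choice[lf lfE] : forall z : subsp M, exists h, K h = subsp_val z.
  by move=> z; apply: range_spaceP; exact: subspP.
have kl z : k (lf z) = z by apply/val_inj; rewrite -[LHS]/(subsp_val _) kK lfE.
have kinj : injective k.
  move=> x y kxy; apply/eqP; rewrite -subr_eq0; apply/eqP/rnorm_eq0/eqP.
  rewrite eq_le rnorm_ge0 andbT (le_trans (bounded_below _))//.
  by rewrite bop_subr -(kK x) -(kK y) kxy subrr rnorm0 mulr0.
have llin : linear lf by move=> c x y; apply: kinj; rewrite bop_linear !kl.
have lbd z : rnorm (lf z) <= (Num.sqrt a)^-1 * rnorm z.
  by rewrite (le_trans (bounded_below _))// lfE.
have [l lE] := bounded_linear_bop llin lbd.
exists k, l; split=> [h|h|z|z]; first exact: kK.
- by apply: kinj; rewrite lE kl.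
- by rewrite lE kl.
- by rewrite lE.
Qed.

End closed_range.

(** The orthogonality defining the projection says [<P x, y> = <x, y>] for [y] in [M], so it
    characterises the adjoint of the inclusion, which also supplies existence. *)
Lemma proj_adj (R : realType) (H : hilbertType R) (M : closed_subspace H) :
  Defs.proj M = adj (subsp_incl M).
Proof.
have subsp_dotE (x y : subsp M) : '[x, y] = '[subsp_val x, subsp_val y] by [].
have inclE (x : subsp M) : subsp_incl M x = subsp_val x by [].
have projP x (y : subsp M) : '[x - subsp_incl M (Defs.proj M x), subsp_incl M y] = 0.
  move: x y; apply: (@xgetPex _ 0 [set P : 'B(H, subsp M) |
    forall x (y : subsp M), '[x - subsp_incl M (P x), subsp_incl M y] = 0]).
  exists (adj (subsp_incl M)) => x y /=.
  by rewrite hdotBl -subsp_dotE -inclE adjPr subrr.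
apply: bop_ext => x; apply: hdot_ext => y.
by rewrite -adjPr subsp_dotE -!inclE; apply/esym/eqP; rewrite -subr_eq0 -hdotBl projP.
Qed.

(* With [k : H -> M] the corestriction of [K] to its range, [K^*] and
   [J = (k^-1)^*] satisfy [K^* J = 1] and implement the similarity. *)
Lemma dilation_similarity (R : realType) (H G : hilbertType R) n (K : 'B(H, G))
    (a : R) (T : 'I_n -> 'B(H)) (V : 'I_n -> 'B(G)) :
  0 < a -> (forall h, a * rnorm h ^+ 2 <= rnorm (K h) ^+ 2) ->
  (forall i, bop_comp (adj K) (V i) = bop_comp (T i) (adj K)) ->
  exists (M : closed_subspace G) (J : 'B(H, G)),
    [/\ forall i x, x \in cs_pred M -> adj (V i) x \in cs_pred M,
        jointly_similar T (fun i => compression M (V i)),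
        forall h, adj K (J h) = h &
        forall h, rnorm (J h) <= (Num.sqrt a)^-1 * rnorm h].
Proof.
move=> a0 Ka KV; pose M := range_space a0 Ka.
have [k [l [kK lk kl lbd]]] := range_iso a0 Ka.
have KE : K = bop_comp (subsp_incl M) k by apply: bop_ext => h /=; rewrite kK.
have adjKE : adj K = bop_comp (adj k) (adj (subsp_incl M)).
  by rewrite -adj_comp; congr adj.
have YX : bop_comp (adj k) (adj l) = bop_id H.
  rewrite -adj_comp (_ : bop_comp l k = 1); first exact: adj1.
  by apply: bop_ext => x /=; rewrite lk.
have XY : bop_comp (adj l) (adj k) = bop_id (subsp M).
  rewrite -adj_comp (_ : bop_comp k l = 1); first exact: adj1.
  by apply: bop_ext => x /=; rewrite kl.
have inclK (z : subsp M) : adj (subsp_incl M) (subsp_incl M z) = z.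
  by apply: hdot_ext => y; rewrite -adjPr.
have KJ h : adj K (subsp_incl M (adj l h)) = h.
  rewrite adjKE /= inclK.
  by have /(congr1 (fun A : 'B(H) => A h)) := YX.
exists M, (bop_comp (subsp_incl M) (adj l)); split=> [i x xM||//|h].
(* Taking adjoints in [KV] gives [V_i^* K = K T_i^*], so the range is invariant. *)
- have [h <-] := range_spaceP xM.
  have /(congr1 (@adj R _ _)) := KV i.
  rewrite !adj_comp adjK => /(congr1 (fun A : 'B(H, G) => A h)) /= ->.
  by apply/asboolP; exists (adj (T i) h).
(* As [adj k] after the projection is [adj K], the right-hand side is
   [K^* V_i J = T_i K^* J = T_i]. *)
- exists (adj l), (adj k); split=> // i; apply: bop_ext => h /=.
  rewrite proj_adj.
  have -> : adj k (adj (subsp_incl M) (V i (subsp_incl M (adj l h)))) =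
      adj K (V i (subsp_incl M (adj l h))) by rewrite adjKE.
  have /(congr1 (fun A : 'B(G, H) => A (subsp_incl M (adj l h)))) /= := KV i.
  by move=> ->; rewrite KJ.
- have sa0 : 0 <= (Num.sqrt a)^-1 by rewrite invr_ge0 sqrtr_ge0.
  exact: (adj_bounded sa0 lbd h).
Qed.

(** * Joint spectral radius *)

Section root_sequences.
Variable R : realType.
Implicit Types (u w : nat -> R) (c : R).

Lemma root_const_cvg c : 0 < c -> powR c (2 * k)%:R^-1 @[k --> \oo] --> (1 : R).
Proof.
move=> c0.
have inv0 : (2 * k)%:R^-1 @[k --> \oo] --> (0 : R).
  apply/cvgrPdist_lt => d d0.
  have /cvgrPdist_lt/(_ _ d0)[N _ Ne] := @cvg_harmonic R.
  exists N.+1 => // -[//|k] /= Nk; apply: le_lt_trans (Ne k Nk).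
  rewrite /= !sub0r !normrN !ger0_norm ?invr_ge0// lef_pV2 ?posrE ?ltr0n//.
  by rewrite ler_nat mul2n -addnn leq_addr.
rewrite /powR gt_eqF//.
rewrite [X in _ --> X](_ : 1 = expR (0 * ln c)); last by rewrite mul0r expR0.
have h : (2 * k)%:R^-1 * ln c @[k --> \oo] --> 0 * ln c.
  by apply: cvgM => //; exact: cvg_cst.
exact: (cvg_comp _ _ h (@continuous_expR R _)).
Qed.

Lemma powR_root (x : R) k : 0 <= x -> (0 < k)%N -> powR x (2 * k)%:R^-1 ^+ (2 * k) = x.
Proof.
move=> x0 k0; rewrite -powR_mulrn ?powR_ge0// -powRrM mulVf ?powRr1//.
by rewrite pnatr_eq0 muln_eq0 -lt0n.
Qed.

(* Fekete's lemma in multiplicative form. *)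
Lemma submultiplicative_root_cvg u : (forall k, 0 <= u k) ->
  (forall k l, u (k + l)%N <= u k * u l) ->
  cvg (powR (u k) (2 * k)%:R^-1 @[k --> \oo]).
Proof.
move=> u0 uM; pose v k := powR (u k) (2 * k)%:R^-1.
pose E := [set v k | k in [set k : nat | (0 < k)%N]].
have hE : has_inf E.
  by split; [exists (v 1), 1|exists 0 => _ [k _ <-]; exact: powR_ge0].
have L0 : 0 <= inf E.
  by apply: lb_le_inf => [|_ [k _ <-]]; [case: hE|exact: powR_ge0].
have Lv k : (0 < k)%N -> inf E <= v k.
  by move=> k0; apply: ge_inf; [case: hE|exists k].
apply/cvg_ex; exists (inf E); apply/cvgrPdist_lt => d d0.
have d2 : 0 < d / 2 by rewrite divr_gt0.
have [_ [m m0 <-] vm] := inf_adherent d2 hE.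
pose rho := inf E + d / 2.
have rho0 : 0 < rho by rewrite ltr_wpDl.
have um : u m <= rho ^+ (2 * m).
  rewrite -(powR_root (u0 m) m0); apply: lerXn2r; rewrite ?nnegrE ?powR_ge0//.
    exact: ltW.
  exact: (ltW vm).
(* [c] dominates [u i / rho ^ (2 i)] for every remainder [i < m]; adding 1 makes it positive. *)
pose c := \sum_(i < m) u i / rho ^+ (2 * i) + 1.
have c0 : 0 < c.
  by rewrite ltr_wpDl// sumr_ge0// => i _; rewrite divr_ge0 ?exprn_ge0 ?(ltW rho0).
have uc k : u k <= c * rho ^+ (2 * k).
  (* Blocks of length [m] are peeled off, each costing a factor [rho ^ (2 m)]. *)
  elim/ltn_ind: k => k IH; case: (ltnP k m) => [km|mk].
    rewrite -ler_pdivrMr ?exprn_gt0// /c (bigD1 (Ordinal km))//= -addrA lerDl.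
    by rewrite addr_ge0// sumr_ge0// => i _; rewrite divr_ge0 ?exprn_ge0 ?(ltW rho0).
  rewrite -(subnK mk) (le_trans (uM _ _))// mulnDr exprD mulrA ler_pM//.
  by apply: IH; rewrite -subn_gt0 subKn.
have vc k : (0 < k)%N -> v k <= powR c (2 * k)%:R^-1 * rho.
  move=> k0; rewrite -(@ler_pXn2r _ (2 * k)) ?muln_gt0//.
  - by rewrite exprMn !powR_root// ltW.
  - by rewrite nnegrE powR_ge0.
  - by rewrite nnegrE mulr_ge0 ?powR_ge0 ?ltW.
have : powR c (2 * k)%:R^-1 * rho @[k --> \oo] --> 1 * rho.
  by apply: cvgM; [exact: root_const_cvg|exact: cvg_cst].
move=> /cvgrPdist_lt/(_ _ d2)[N _ Ne]; exists N.+1 => // k /= Nk.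
have k0 : (0 < k)%N by exact: leq_ltn_trans Nk.
have := Ne k (ltnW Nk); have := vc k k0; have := Lv k k0.
rewrite mul1r /rho /v ltr_norml => h1 h2 /andP[h3 h4].
rewrite distrC ger0_norm ?subr_ge0//; move: h1 h2 h3; rewrite /rho /v; lra.
Qed.

Lemma root_lim_le u w c : 0 < c -> (forall k, 0 <= u k) -> (forall k, 0 <= w k) ->
  (forall k, u k <= c * w k) ->
  cvg (powR (u k) (2 * k)%:R^-1 @[k --> \oo]) ->
  cvg (powR (w k) (2 * k)%:R^-1 @[k --> \oo]) ->
  lim (powR (u k) (2 * k)%:R^-1 @[k --> \oo]) <=
  lim (powR (w k) (2 * k)%:R^-1 @[k --> \oo]).
Proof.
move=> c0 u0 w0 uw cu cw.
have cw1 : powR c (2 * k)%:R^-1 * powR (w k) (2 * k)%:R^-1 @[k --> \oo] -->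
    1 * lim (powR (w k) (2 * k)%:R^-1 @[k --> \oo]).
  by apply: cvgM => //; exact: root_const_cvg.
rewrite -[leRHS]mul1r; apply: (ler_cvg_to cu cw1); apply: nearW => k.
rewrite -powRM ?(ltW c0)//; apply: ge0_ler_powR => //; rewrite ?nnegrE ?invr_ge0//.
by rewrite mulr_ge0// ltW.
Qed.

End root_sequences.

Section joint_spectral_radius.
Variables (R : realType) (n : nat).

Section row_norms.
Variables (H : hilbertType R) (T : 'I_n -> 'B(H)).

Lemma word_op_cat u v : word_op T (u ++ v) = word_op T u * word_op T v.
Proof. exact: big_cat. Qed.

Lemma word_op_cons i w : word_op T (i :: w) = T i * word_op T w.
Proof. exact: big_cons. Qed.

(** The row of all [T_w] with [|w| = k] times its adjoint: its norm is the square of the norm of the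
    column [x |-> (T_w^* x)_w]. *)
Definition row_op k : 'B(H) :=
  \sum_(w : k.-tuple 'I_n) word_op T w * adj (word_op T w).

Lemma rdot_row_op k x :
  rdot (row_op k x) x = \sum_(w : k.-tuple 'I_n) rnorm (adj (word_op T w) x) ^+ 2.
Proof.
rewrite bop_sum /rdot hdot_suml Re_sum.
by apply: eq_bigr => w _; rewrite bopM adjP hdotxx.
Qed.

Lemma rnorm_row_op_le k (C : R) : 0 <= C ->
  (forall x, \sum_(w : k.-tuple 'I_n) rnorm (adj (word_op T w) x) ^+ 2 <=
    C * rnorm x ^+ 2) -> rnorm (row_op k) <= C.
Proof.
move=> Cge0 leC; rewrite rnorm_bop; apply: opnorm_bounded => //.
apply: form_bounded => // [x y|x|x]; rewrite ?rdot_row_op//.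
  rewrite !bop_sum /rdot !hdot_suml !Re_sum.
  by apply: eq_bigr => w _; rewrite !bopM -!/(rdot _ _) rdot_adj [RHS]rdot_adj rdotC.
by rewrite sumr_ge0// => w _; exact: sqr_ge0.
Qed.

Lemma row_op_bound k x :
  \sum_(w : k.-tuple 'I_n) rnorm (adj (word_op T w) x) ^+ 2 <=
  rnorm (row_op k) * rnorm x ^+ 2.
Proof.
rewrite -rdot_row_op (le_trans (ler_norm _))//.
rewrite (le_trans (rdot_CauchySchwarz _ _))// expr2 mulrA ler_wpM2r ?rnorm_ge0//.
exact: opnorm_bound.
Qed.

(** Since [T_uv^* = T_v^* T_u^*], the bound for length [l] is applied at each [T_u^* x], and then
    the bound for length [k] at [x]. *)
Lemma row_op_submultiplicative k l :
  rnorm (row_op (k + l)) <= rnorm (row_op k) * rnorm (row_op l).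
Proof.
apply: rnorm_row_op_le => [|x]; first by rewrite mulr_ge0 ?rnorm_ge0.
rewrite (big_tuple_cat k l (fun w => rnorm (adj (word_op T w) x) ^+ 2)).
apply: le_trans (_ : \sum_(u : k.-tuple 'I_n)
  rnorm (row_op l) * rnorm (adj (word_op T u) x) ^+ 2 <= _).
  apply: ler_sum => u _; apply: le_trans (row_op_bound _ _).
  by apply: ler_sum => v _; rewrite word_op_cat adj_comp.
by rewrite -mulr_sumr -mulrA mulrCA ler_wpM2l ?rnorm_ge0 ?row_op_bound.
Qed.

Lemma joint_spectral_radius_cvg :
  cvg (powR (rnorm (row_op k)) (2 * k)%:R^-1 @[k --> \oo]).
Proof.
apply: submultiplicative_root_cvg => [k|]; first exact: rnorm_ge0.
exact: row_op_submultiplicative.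
Qed.

End row_norms.

Lemma joint_spectral_radius_le (H G : hilbertType R)
    (T : 'I_n -> 'B(H)) (W : 'I_n -> 'B(G)) (c : R) : 0 < c ->
  (forall k, rnorm (row_op T k) <= c * rnorm (row_op W k)) ->
  joint_spectral_radius T <= joint_spectral_radius W.
Proof.
move=> c0 TW; apply: (root_lim_le c0) => // [k|k||]; try exact: rnorm_ge0.
- exact: joint_spectral_radius_cvg.
- exact: joint_spectral_radius_cvg.
Qed.

End joint_spectral_radius.

(** * Polynomials and functional calculus *)

Section polynomials.
Variables (R : realType) (n : nat) (H : hilbertType R) (T : 'I_n -> 'B(H)).
Implicit Types p q : {malg R[i][seq 'I_n]}.

Lemma nc_eval_supp (d : {fset seq 'I_n}) p : (msupp p `<=` d)%fset ->
  nc_eval T p = \sum_(w <- d) p@_w *: word_op T w.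
Proof.
move=> le; rewrite /nc_eval [LHS](big_fset_incl _ le) //= => x xd /mcoeff_outdom ->.
by rewrite scale0r.
Qed.

Lemma nc_eval_linear k p q : nc_eval T (k *: p + q) = k *: nc_eval T p + nc_eval T q.
Proof.
pose d := (msupp p `|` msupp q)%fset.
have pd : (msupp p `<=` d)%fset by exact: fsubsetUl.
have qd : (msupp q `<=` d)%fset by exact: fsubsetUr.
have kpq : (msupp (k *: p + q) `<=` d)%fset.
  apply: fsubset_trans (msuppD_le _ _) _; rewrite fsubUset qd andbT.
  by apply: fsubset_trans (msuppZ_le _ _) _.
rewrite !(nc_eval_supp pd, nc_eval_supp qd, nc_eval_supp kpq) scaler_sumr -big_split.
by apply: eq_bigr => w _; rewrite mcoeffD mcoeffZ scalerDl scalerA.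
Qed.

Lemma nc_evalU w : nc_eval T << w >> = word_op T w.
Proof.
by rewrite (nc_eval_supp msuppU_le) big_seq_fset1 mcoeffUU scale1r.
Qed.

Definition polynomials : set 'B(H) := range (nc_eval T).

Lemma polynomials_linear k A B :
  polynomials A -> polynomials B -> polynomials (k *: A + B).
Proof.
by move=> [p _ <-] [q _ <-]; exists (k *: p + q) => //; rewrite nc_eval_linear.
Qed.

Lemma polynomials0 : polynomials 0.
Proof. by exists 0 => //; rewrite /nc_eval msupp0 big_seq_fset0. Qed.

Lemma polynomials_sum I (r : seq I) (f : I -> 'B(H)) :
  (forall i, polynomials (f i)) -> polynomials (\sum_(i <- r) f i).
Proof.
move=> fp; elim: r => [|i r IH]; first by rewrite big_nil; exact: polynomials0.
by rewrite big_cons -[f i]scale1r; exact: polynomials_linear.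
Qed.

Lemma polynomialsZ k A : polynomials A -> polynomials (k *: A).
Proof.
by move=> Ap; rewrite -[_ *: _]addr0; apply: polynomials_linear => //; exact: polynomials0.
Qed.

Lemma polynomials_word w : polynomials (word_op T w).
Proof. by exists << w >> => //; rewrite nc_evalU. Qed.

Lemma polynomialsM A B : polynomials A -> polynomials B -> polynomials (A * B).
Proof.
move=> [p _ <-] [q _ <-]; rewrite /nc_eval mulr_suml; apply: polynomials_sum => u.
rewrite mulr_sumr; apply: polynomials_sum => v.
have -> : p@_u *: word_op T u * (q@_v *: word_op T v) =
    (p@_u * q@_v) *: word_op T (u ++ v).
  by apply: bop_ext => x; rewrite bopM !bopZ linearZ word_op_cat bopM scalerA.
by apply: polynomialsZ; exact: polynomials_word.
Qed.

Lemma polynomials_closed_algebra A :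
  polynomials A -> A \in cs_pred (closed_algebra T).
Proof.
move=> [p _ <-]; apply/asboolP => P [[P0 PD] [P1 PM] _ PT].
have Pw w : word_op T w \in P.
  elim: w => [|i w IH]; first by rewrite /word_op big_nil.
  by rewrite word_op_cons; exact: PM.
rewrite /nc_eval; elim: (enum_fset (msupp p)) => [|w s IH]; first by rewrite big_nil.
by rewrite big_cons; exact: PD.
Qed.

(** The closure of the polynomials is itself a closed algebra containing all [T i], hence contains
    the least one. *)
Lemma polynomials_dense A : A \in cs_pred (closed_algebra T) ->
  exists u : nat -> 'B(H), (forall m, polynomials (u m)) /\ u @ \oo --> A.
Proof.
pose P : {pred 'B(H)} := fun A => `[< closure polynomials A >].
have PE B : reflect (exists u : nat -> 'B(H), (forall m, polynomials (u m)) /\ u @ \oo --> B) (B \in P).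
  by apply: (iffP (asboolP _)) => /closure_rcvgP.
move=> /asboolP/(_ P) AP; apply/PE; apply: AP; split.
- split; first by apply/asboolP/subset_closure; exact: polynomials0.
  move=> k B C /PE[u [pu uB]] /PE[v [pv vC]]; apply/PE.
  exists (fun m => k *: u m + v m); split=> [m|]; first exact: polynomials_linear.
  by apply: cvgD => //; exact: cvgZr.
- split.
    apply/asboolP/subset_closure; have <- : word_op T [::] = 1 by rewrite /word_op big_nil.
    exact: polynomials_word.
  move=> B C /PE[u [pu uB]] /PE[v [pv vC]]; apply/PE.
  exists (fun m => u m * v m); split=> [m|]; first exact: polynomialsM.
  exact: bopM_cvg.
- rewrite (_ : [set` P] = closure polynomials); first exact: closed_closure.
  by apply/seteqP; split => B /asboolP.
- move=> i; apply/asboolP/subset_closure.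
  have -> : T i = word_op T [:: i] by rewrite /word_op big_seq1.
  exact: polynomials_word.
Qed.

End polynomials.

(** * Norms of operator matrices *)

Section matrix_norms.
Variables (R : realType) (V W : normedModType R[i]) (k : nat).
Implicit Types (A : 'M['B(V, W)]_k) (x : 'I_k -> V).

Lemma mx_opnorm_le A (c : R) : 0 <= c ->
  (forall x, \sum_i rnorm (\sum_j A i j (x j)) ^+ 2 <= c * \sum_j rnorm (x j) ^+ 2) ->
  mx_opnorm A <= Num.sqrt c.
Proof.
move=> c0 Ac; apply: ge_sup.
  by eexists; exists (fun=> 0) => //=; rewrite big1// => j _; rewrite rnorm0 expr0n.
move=> _ [x /= x1 <-]; rewrite ler_sqrt// (le_trans (Ac x))//.
by rewrite ler_piMr.
Qed.

(** A crude bound by the norms of the entries shows that the supremum is over a bounded set; a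
    nonzero [x] is then scaled to the unit sphere. The factor 1 matches the form of
    [amp_mx_estimate]. *)
Lemma mx_opnorm_bound A : mx_opnorm A <= 1 ->
  forall x, \sum_i rnorm (\sum_j A i j (x j)) ^+ 2 <= 1 * \sum_j rnorm (x j) ^+ 2.
Proof.
move=> A1 x; rewrite mul1r; pose s := \sum_j rnorm (x j) ^+ 2.
have sq0 (U : normedModType R[i]) (y : U) : 0 <= rnorm y ^+ 2 by exact: sqr_ge0.
have hub : has_ubound [set Num.sqrt (\sum_i rnorm (\sum_j A i j (x j)) ^+ 2)
      | x in [set x : 'I_k -> V | \sum_j rnorm (x j) ^+ 2 <= 1]].
  exists (Num.sqrt (\sum_i (\sum_j opnorm (A i j)) ^+ 2)) => _ [y /= y1 <-].
  rewrite ler_sqrt; last by rewrite sumr_ge0// => i _; exact: sqr_ge0.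
  apply: ler_sum => i _; apply: lerXn2r; rewrite ?nnegrE ?rnorm_ge0//.
    by rewrite sumr_ge0// => j _; exact: opnorm_ge0.
  rewrite (le_trans (rnorm_sum _ _))//; apply: ler_sum => j _.
  apply: opnorm_unit; rewrite -(@ler_pXn2r _ 2) ?nnegrE ?rnorm_ge0// expr1n.
  by apply: le_trans y1; rewrite (bigD1 j)//= lerDl sumr_ge0.
have [s0|] := eqVneq s 0.
  have x0 j : x j = 0.
    apply: rnorm_eq0; apply/eqP; rewrite -sqrf_eq0; apply/eqP.
    by have /psumr_eq0P := s0; apply.
  rewrite -/s s0 big1// => i _; rewrite big1 ?rnorm0 ?expr0n// => j _.
  by rewrite x0 linear0.
move=> sn0; have s_gt0 : 0 < s by rewrite lt_def sn0 sumr_ge0.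
pose c := (Num.sqrt s)^-1; have c0 : 0 <= c by rewrite invr_ge0 sqrtr_ge0.
have c2 : c ^+ 2 = s^-1 by rewrite /c exprVn sqr_sqrtr// ltW.
have : Num.sqrt (\sum_i rnorm (\sum_j A i j (c%:C *: x j)) ^+ 2) <= Num.sqrt 1.
  rewrite sqrtr1; apply: le_trans A1; apply: ub_le_sup => //; exists (fun j => c%:C *: x j) => //=.
  rewrite (_ : \sum_j _ = c ^+ 2 * s).
    by rewrite c2 mulVf.
  by rewrite /s mulr_sumr; apply: eq_bigr => j _; rewrite rnormZ ger0_norm// exprMn.
rewrite ler_sqrt//.
rewrite (_ : \sum_i _ = c ^+ 2 * \sum_i rnorm (\sum_j A i j (x j)) ^+ 2).
  by rewrite c2 ler_pdivrMl// mulr1.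
rewrite mulr_sumr; apply: eq_bigr => i _.
rewrite -exprMn; congr (_ ^+ 2); rewrite -[c in RHS]ger0_norm// -rnormZ.
by rewrite scaler_sumr; congr rnorm; apply: eq_bigr => j _; rewrite linearZ.
Qed.

End matrix_norms.

(** * Consequences of the intertwining relation *)

Section intertwining.
Variables (R : realType) (n : nat) (F H FH : hilbertType R).
Variables (e : seq 'I_n -> F) (eP : orthonormal_basis e).
Variables (t : {bilinear F -> H -> FH}) (tP : hilbert_tensor t).
Variables (W : 'I_n -> 'B(F)) (T : 'I_n -> 'B(H)) (K : 'B(H, FH)).

Notation amp A := (tensor_op t A (bop_id H)).

Let exh := @words_exhaust n.
Let mono := @wordsS n.
Let uniqw := @uniq_words n.

Let ampE A x y : amp A (t x y) = t (A x) y.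
Proof. exact: (tensor_opP tP eP uniqw mono exh). Qed.

Hypothesis KW : forall i, bop_comp (adj K) (amp (W i)) = bop_comp (T i) (adj K).

Lemma intertwine_word w z :
  adj K (amp (word_op W w) z) = word_op T w (adj K z).
Proof.
elim: w z => [|i w IH] z.
  by rewrite /word_op !big_nil (amp1 tP eP uniqw mono exh).
rewrite !word_op_cons (ampM tP eP uniqw mono exh) !bopM -IH.
by have /(congr1 (fun A : 'B(FH, H) => A (amp (word_op W w) z))) := KW i.
Qed.

Lemma intertwine_nc_eval p z : adj K (amp (nc_eval W p) z) = nc_eval T p (adj K z).
Proof.
rewrite /nc_eval (amp_sum tP eP uniqw mono exh) !bop_sum bop_sumr.
apply: eq_bigr => w _; rewrite (ampZ tP eP uniqw mono exh) !bopZ linearZ.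
by rewrite -intertwine_word.
Qed.

(** Summing over the words of length [k], [a |T_w^* x|^2 <= |K T_w^* x|^2 = |(W_w^* (x) I) K x|^2];
    the sum of the last terms is at most [|row_op W k| |K x|^2], and [|K x|^2 <= b |x|^2]. *)
Lemma row_op_intertwined_le (a b : R) k : 0 < a -> a <= b ->
  (forall h, a * rnorm h ^+ 2 <= rnorm (K h) ^+ 2 <= b * rnorm h ^+ 2) ->
  rnorm (row_op T k) <= b / a * rnorm (row_op W k).
Proof.
move=> a0 ab Kab; have b0 : 0 < b by exact: lt_le_trans ab.
apply: rnorm_row_op_le => [|x]; first by rewrite mulr_ge0 ?divr_ge0 ?rnorm_ge0 ?ltW.
have KT w : K (adj (word_op T w) x) = amp (adj (word_op W w)) (K x).
  rewrite -(adj_amp tP eP uniqw mono exh); apply: hdot_extr => z.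
  by rewrite !adjPr !adjK intertwine_word.
have ampP_le z : \sum_(w : k.-tuple 'I_n) rnorm (amp (adj (word_op W w)) z) ^+ 2 <=
    rnorm (row_op W k) * rnorm z ^+ 2.
  have -> : \sum_(w : k.-tuple 'I_n) rnorm (amp (adj (word_op W w)) z) ^+ 2 =
      rdot (amp (row_op W k) z) z.
    rewrite (amp_sum tP eP uniqw mono exh) bop_sum /rdot hdot_suml Re_sum.
    apply: eq_bigr => w _; rewrite (ampM tP eP uniqw mono exh) bopM.
    by rewrite -(adj_amp tP eP uniqw mono exh) -/(rdot _ _) rdot_adj rdotxx.
  rewrite (le_trans (ler_norm _))// (le_trans (rdot_CauchySchwarz _ _))//.
  rewrite expr2 mulrA ler_wpM2r ?rnorm_ge0// (le_trans (opnorm_bound _ _))//.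
  by rewrite ler_wpM2r ?rnorm_ge0// (opnorm_amp_le tP eP uniqw mono exh).
have cancel_a (r s : R) : a * (b / a * r * s) = r * (b * s).
  by field; rewrite gt_eqF.
rewrite -(ler_pM2l a0) cancel_a mulr_sumr.
apply: le_trans (_ : rnorm (row_op W k) * rnorm (K x) ^+ 2 <= _).
  apply: le_trans (ampP_le (K x)); apply: ler_sum => w _; rewrite -KT.
  by have /andP[] := Kab (adj (word_op T w) x).
by rewrite ler_wpM2l ?rnorm_ge0//; have /andP[] := Kab x.
Qed.

(* [Phi A = K^* (A (x) 1) J] where [J] is a right inverse of [K^*]: this is
   [p(W) |-> p(T)] on polynomials and its cb-norm is at most [|K^*| |J|]. *)
Lemma functional_calculus (a b : R) (J : 'B(H, FH)) : 0 < a -> a <= b ->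
  (forall h, rnorm (K h) ^+ 2 <= b * rnorm h ^+ 2) ->
  (forall h, adj K (J h) = h) ->
  (forall h, rnorm (J h) <= (Num.sqrt a)^-1 * rnorm h) ->
  exists Phi : {linear subsp (closed_algebra W) -> 'B(H)},
    [/\ continuous Phi,
        forall p A, subsp_val A = nc_eval W p -> Phi A = nc_eval T p,
        forall Psi : subsp (closed_algebra W) -> 'B(H), continuous Psi ->
          (forall p A, subsp_val A = nc_eval W p -> Psi A = nc_eval T p) ->
          Psi =1 Phi,
        completely_bounded Phi &
        (cb_norm Phi <= (Num.sqrt (b / a))%:E)%E].
Proof.
move=> a0 ab Kb KJ Ja; have b0 : 0 < b by exact: lt_le_trans ab.
have KJ_le (z : FH) : rnorm (adj K z) <= Num.sqrt b * rnorm z.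
  apply: adj_bounded => [|h]; first exact: sqrtr_ge0.
  rewrite -ler_sqr ?nnegrE ?mulr_ge0 ?rnorm_ge0 ?sqrtr_ge0//.
  by rewrite exprMn sqr_sqrtr ?Kb// ltW.
pose phi (A : subsp (closed_algebra W)) : 'B(H) :=
  bop_comp (adj K) (bop_comp (amp (subsp_val A)) J).
have phi_lin : linear phi.
  move=> k A B; apply: bop_ext => x; rewrite bopD bopZ /=.
  by rewrite (amp_linear tP eP uniqw mono exh) bopD bopZ bop_linear.
have phi_bd A : rnorm (phi A) <= Num.sqrt b * (Num.sqrt a)^-1 * rnorm A.
  rewrite rnorm_bop; apply: opnorm_bounded => [|x].
    by rewrite !mulr_ge0 ?invr_ge0 ?sqrtr_ge0 ?rnorm_ge0.
  rewrite (le_trans (KJ_le _))// -!mulrA ler_wpM2l ?sqrtr_ge0//.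
  rewrite (le_trans (opnorm_bound (amp (subsp_val A)) (J x)))// mulrCA.
  apply: ler_pM; rewrite ?opnorm_ge0 ?rnorm_ge0//.
  exact: (opnorm_amp_le tP eP uniqw mono exh).
(* [phi A] depends on the operator [A] alone, so [p(W) = q(W)] forces [p(T) = q(T)]: the calculus is
   well defined on polynomials. *)
have phi_poly p A : subsp_val A = nc_eval W p -> phi A = nc_eval T p.
  by move=> AE; apply: bop_ext => x; rewrite /= AE intertwine_nc_eval KJ.
have phi_cont : continuous phi.
  have [B BE] := bounded_linear_bop phi_lin phi_bd.
  by have -> : phi = B by [apply/funext => A; rewrite BE]; exact: bop_continuous.
pose Phi : {linear subsp (closed_algebra W) -> 'B(H)} :=
  HB.pack phi (GRing.isLinear.Build _ _ _ _ phi phi_lin).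
have cb : (cb_norm Phi <= (Num.sqrt (b / a))%:E)%E.
  (* [adj K] and [J] act entrywise on columns, so for every matrix size they contribute [b] and
     [a^-1] to the squared norm, while the amplified matrix contributes at most 1. *)
  apply: ge_ereal_sup => _ [k [A [A1 ->]]]; rewrite lee_fin.
  apply: mx_opnorm_le => [|x]; first by rewrite divr_ge0 ?ltW.
  have := @amp_mx_estimate _ _ _ _ _ _ tP _ eP _ uniqw mono exh k
    (map_mx (@subsp_val _ _ _) A) 1 (fun j => J (x j)) (mx_opnorm_bound A1).
  rewrite mul1r => est.
  apply: le_trans (_ : b * \sum_j rnorm (J (x j)) ^+ 2 <= _); last first.
    rewrite -mulrA ler_wpM2l ?(ltW b0)// mulr_sumr; apply: ler_sum => j _.
    rewrite -[a^-1]sqr_sqrtr ?invr_ge0 ?(ltW a0)// sqrtrV ?(ltW a0)// -exprMn.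
    by rewrite ler_sqr ?nnegrE ?mulr_ge0 ?rnorm_ge0 ?invr_ge0 ?sqrtr_ge0.
  apply: le_trans (_ : b * \sum_i rnorm (\sum_j amp (subsp_val (A i j)) (J (x j))) ^+ 2 <= _).
    rewrite mulr_sumr; apply: ler_sum => i _.
    rewrite (_ : \sum_j _ = adj K (\sum_j amp (subsp_val (A i j)) (J (x j)))).
      rewrite -[b]sqr_sqrtr ?(ltW b0)// -exprMn.
      by rewrite ler_sqr ?nnegrE ?mulr_ge0 ?rnorm_ge0 ?sqrtr_ge0.
    by rewrite bop_sumr; apply: eq_bigr => j _; rewrite mxE.
  rewrite ler_wpM2l ?(ltW b0)//; apply: le_trans est.
  rewrite le_eqVlt; apply/orP; left; apply/eqP.
  apply: eq_bigr => i _; congr (rnorm _ ^+ 2).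
  by apply: eq_bigr => j _; rewrite mxE.
exists Phi; split=> // [Psi Psi_cont Psi_poly A|]; last first.
  by rewrite /completely_bounded (le_lt_trans cb)// ltry.
(* Uniqueness: two continuous maps that agree on the dense set of polynomials coincide. *)
have [u [up uA]] := polynomials_dense (subspP A).
pose x m : subsp (closed_algebra W) := Subsp (polynomials_closed_algebra (up m)).
have xA : x @ \oo --> A by apply/rcvgP; exact: (proj1 (rcvgP _ _) uA).
have PsiA : Psi (x m) @[m --> \oo] --> Psi A by apply: continuous_cvg xA; exact: Psi_cont.
have PhiA : phi (x m) @[m --> \oo] --> phi A by apply: continuous_cvg xA; exact: phi_cont.
apply: (cvg_unique (@norm_hausdorff _ 'B(H)) PsiA).
rewrite (_ : (fun m => Psi (x m)) = fun m => phi (x m))//.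
apply/funext => m; have [p _ pE] := up m.
by rewrite (Psi_poly p) ?(phi_poly p).
Qed.

End intertwining.

Theorem theorem2p1 (R : realType) (n : nat) (n_ge1 : (1 <= n)%N)
    (mu : seq 'I_n -> R)
    (mu_gt0 : forall w, (1 <= size w)%N -> 0 < mu w)
    (mu_bounded : forall i, has_ubound (range (fun w => mu (i :: w))))
    (F : hilbertType R) (e : seq 'I_n -> F) (eP : orthonormal_basis e)
    (W : 'I_n -> 'B(F)) (WP : is_weighted_shift mu e W)
    (H : hilbertType R)
    (FH : hilbertType R) (tens : {bilinear F -> H -> FH})
    (tensP : hilbert_tensor tens)
    (T : 'I_n -> 'B(H)) (Q : 'B(H)) (Q_psd : psd Q) (Q_inv : invertible Q)
    (a b : R) (a_gt0 : 0 < a) (a_le_b : a <= b)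
    (S : 'B(H))
    (S_series : wot_series (fun k => \sum_(w : k.-tuple 'I_n)
       ((weight_prod mu w) ^- 2)%:C *: (word_op T w * Q * adj (word_op T w))) S)
    (S_ge : op_le (a%:C *: bop_id H) S) (S_le : op_le S (b%:C *: bop_id H)) :
  [/\ exists M : closed_subspace FH,
        (forall i x, x \in cs_pred M ->
           tensor_op tens (adj (W i)) (bop_id H) x \in cs_pred M) /\
        jointly_similar T (fun i => compression M (tensor_op tens (W i) (bop_id H))),
      joint_spectral_radius T <= joint_spectral_radius W &
      exists Phi : {linear subsp (closed_algebra W) -> 'B(H)},
        [/\ continuous Phi,
            forall p A, subsp_val A = nc_eval W p -> Phi A = nc_eval T p,
            forall Psi : subsp (closed_algebra W) -> 'B(H), continuous Psi ->
              (forall p A, subsp_val A = nc_eval W p -> Psi A = nc_eval T p) ->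
              Psi =1 Phi,
            completely_bounded Phi &
            (cb_norm Phi <= (Num.sqrt (b / a))%:E)%E]].
Proof.
have [L LQ] := psd_invertible_root Q_psd Q_inv.
have [K [KS KT]] := poisson_kernel_exists eP tensP LQ S_series.
have Kab h : a * rnorm h ^+ 2 <= rnorm (K h) ^+ 2 <= b * rnorm h ^+ 2.
  rewrite KS; apply/andP; split.
    have := psd_rdot_ge0 h S_ge.
    by rewrite bopB bopZ rdotDl rdotNl rdotZl rdotxx subr_ge0.
  have := psd_rdot_ge0 h S_le.
  by rewrite bopB bopZ rdotDl rdotNl rdotZl rdotxx subr_ge0.
have exh := @words_exhaust n; have mono := @wordsS n; have uniqw := @uniq_words n.
have KW i : bop_comp (adj K) (tensor_op tens (W i) (bop_id H)) =
    bop_comp (T i) (adj K).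
  (* On [e_w (x) y] the weight of the shift cancels the leading factor of the weight product:
     [mu_iw / mu(iw, g_0) = 1 / mu(w, g_0)]. *)
  apply: (bop_total_ext (tens_basis_total tensP eP)) => _ [w _ [y _ <-]] /=.
  rewrite (tensor_opP tensP eP uniqw mono exh) WP tensZl linearZ/= !KT scalerA.
  rewrite -real_complexM linearZ/= word_op_cons bopM; congr (_%:C *: _).
  by rewrite weight_prod_cons invfM mulVKf// gt_eqF// mu_gt0.
have [M [J [MW TM KJ Jle]]] :=
  dilation_similarity a_gt0 (fun h => proj1 (andP (Kab h))) KW.
split.
- exists M; split=> // i x.
  by rewrite -(adj_amp tensP eP uniqw mono exh); exact: MW.
- apply: (@joint_spectral_radius_le _ _ _ _ _ _ (b / a)) => [|k].
    by rewrite divr_gt0// (lt_le_trans a_gt0).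
  exact: (row_op_intertwined_le eP tensP KW k a_gt0 a_le_b Kab).
- apply: (functional_calculus eP tensP KW a_gt0 a_le_b _ KJ Jle) => h.
  by case/andP: (Kab h).
Qed.
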